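(* Consider a non-singular zero-drift model with small steps such that $\pi/\theta\in\mathbb Z$. For $k\ge1$ let $\mathcal L(h_1^k)(x,y)=\frac{\hat\omega(x)^k-\hat\omega(c_+y)^k}{\gamma(x,y)}$, and define inductively $$\mathcal L(h_n^k)(x,y)=\frac{\mathcal L(h_{n-1}^k)(x,y)-f_{n-1}(x)-\big[\mathcal L(h_{n-1}^k)(c_+y,y)-f_{n-1}(c_+y)\big]}{\gamma(x,y)},$$ where $f_{n-1}(x)=\beta x^{m}$ is a continuous decoupling function of $\mathcal L(h_{n-1}^k)$. Here $m$ is the degree of homogeneity of $\mathcal L(h_{n-1}^k)(c_+y,y)$, $\beta=0$ when $c_+^m=c_-^m$, and such a function exists. Then: - each $\mathcal L(h_n^k)$ is the Laplace transform of a continuous $n$-polyharmonic function $h_n^k$ with $\Delta h_n^k=h_{n-1}^k$; - for each $n,k$, $\mathcal L(h_n^k)(x,y)=\frac{q_{n,k}(x,y)}{x^\alpha y^\alpha}$ with $\alpha\in\mathbb N$ and $q_{n,k}$ a homogeneous polynomial.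
   Context: Let $p_{i,j}\ge0$, $(i,j)\in\{-1,0,1\}^2$, sum to $1$, non-degenerate (the list $p_{1,1},p_{1,0},p_{1,-1},p_{0,-1},p_{-1,-1},p_{-1,0},p_{-1,1},p_{0,1}$ has no three consecutive zeros) with zero drift. Covariances: $\sigma_{11}=\sum i^2p_{i,j}$, $\sigma_{12}=\sum ijp_{i,j}$, $\sigma_{22}=\sum j^2p_{i,j}$, and $\theta=\arccos(-\sigma_{12}/\sqrt{\sigma_{11}\sigma_{22}})$. Continuous kernel and gluing function: - $\gamma(x,y)=\frac12(\sigma_{11}x^2+2\sigma_{12}xy+\sigma_{22}y^2)$; - $c_\pm=\sqrt{\sigma_{22}/\sigma_{11}}\,e^{\pm i\theta}$, so $\gamma(c_\pm y,y)=0$; - $\hat\omega(x)=x^{-\pi/\theta}$. Continuous Laplacian: $\Delta=\frac12(\sigma_{11}\partial_u^2+2\sigma_{12}\partial_u\partial_v+\sigma_{22}\partial_v^2)$. A function $h$ on $[0,\infty)^2$ is (continuous) $n$-polyharmonic if $\Delta^nh=0$ in the open quarter plane and $h=0$ on its boundary. $\mathcal L(h)(x,y)=\int_0^\infty\int_0^\infty e^{-ux-vy}h(u,v)\,du\,dv$, and $h_0^k:=0$. Continuous decoupling: a function $f$ is a continuous decoupling function of $\mathcal L(h)$ if $f(c_+y)-f(c_-y)=\mathcal L(h)(c_+y,y)-\mathcal L(h)(c_-y,y)$ for all $y$. A function $T$ is homogeneous of degree $m$ if $T(\lambda x,\lambda y)=\lambda^mT(x,y)$. *)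

(* Defs.v *)
From Stdlib Require Import Reals ZArith List.
From Coquelicot Require Import Coquelicot.
Import ListNotations.
Open Scope R_scope.

(* Step weights: only the values [p i j] with [i], [j] in {-1, 0, 1} are ever
   used. *)

Definition small : list Z := [-1; 0; 1]%Z.

Definition step_sum (g : Z -> Z -> R) : R :=
  fold_right Rplus 0
    (map (fun i => fold_right Rplus 0 (map (g i) small)) small).

(* The eight neighbours of the origin, listed clockwise from (1,1). *)
Definition neighbours (p : Z -> Z -> R) : list R :=
  [p 1 1; p 1 0; p 1 (-1); p 0 (-1); p (-1) (-1); p (-1) 0; p (-1) 1; p 0 1]%Z.

(* The list is read linearly; for a zero drift model the cyclic reading gives
   the same condition. *)
Definition non_degenerate (p : Z -> Z -> R) : Prop :=
  forall i : nat, (i + 2 < 8)%nat ->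
    ~ (nth i (neighbours p) 0 = 0 /\
       nth (i + 1) (neighbours p) 0 = 0 /\
       nth (i + 2) (neighbours p) 0 = 0).

Record zero_drift_model (p : Z -> Z -> R) : Prop := {
  zdm_nonneg : forall i j : Z, In i small -> In j small -> 0 <= p i j;
  zdm_total : step_sum p = 1;
  zdm_non_degenerate : non_degenerate p;
  zdm_drift_x : step_sum (fun i j => IZR i * p i j) = 0;
  zdm_drift_y : step_sum (fun i j => IZR j * p i j) = 0
}.

Definition sigma11 (p : Z -> Z -> R) : R :=
  step_sum (fun i j => IZR i ^ 2 * p i j).
Definition sigma12 (p : Z -> Z -> R) : R :=
  step_sum (fun i j => IZR i * IZR j * p i j).
Definition sigma22 (p : Z -> Z -> R) : R :=
  step_sum (fun i j => IZR j ^ 2 * p i j).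

Definition theta (p : Z -> Z -> R) : R :=
  acos (- sigma12 p / sqrt (sigma11 p * sigma22 p)).

Definition Cexp (z : C) : C :=
  (exp (Re z) * cos (Im z), exp (Re z) * sin (Im z)).

Definition CpowZ (z : C) (m : Z) : C :=
  match m with
  | Z0 => 1
  | Zpos n => (z ^ Pos.to_nat n)%C
  | Zneg n => (/ z ^ Pos.to_nat n)%C
  end.

Definition gamma (p : Z -> Z -> R) (x y : C) : C :=
  (/ 2 * (sigma11 p * x ^ 2 + 2 * sigma12 p * x * y + sigma22 p * y ^ 2))%C.

Definition c_plus (p : Z -> Z -> R) : C :=
  (sqrt (sigma22 p / sigma11 p) * Cexp (Ci * theta p))%C.
Definition c_minus (p : Z -> Z -> R) : C :=
  (sqrt (sigma22 p / sigma11 p) * Cexp (- (Ci * theta p)))%C.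

(* [N] stands for the integer [PI / theta p], so that the power x^(-PI/theta)
   is single-valued on the non-zero complex numbers. *)
Definition omega_hat (N : Z) (x : C) : C := CpowZ x (- N).

Definition laplacian (p : Z -> Z -> R) (h : R -> R -> R) (u v : R) : R :=
  / 2 * (sigma11 p * partial_derive 2 0 h u v
         + 2 * sigma12 p * partial_derive 1 1 h u v
         + sigma22 p * partial_derive 0 2 h u v).

(* [Derive] is total, so the regularity needed for the n-th iterate of the
   Laplacian to be meaningful is required explicitly: [h] is of class C^(2n)
   in the open quarter plane.  Continuity up to the boundary is what ties the
   boundary values to the values inside. *)
Definition polyharmonic (p : Z -> Z -> R) (n : nat) (h : R -> R -> R) : Prop :=
  (forall u v : R, 0 < u -> 0 < v ->
     ex_diff_n h (2 * n) u v /\ Nat.iter n (laplacian p) h u v = 0) /\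
  (forall u v : R, 0 <= u -> 0 <= v ->
     filterlim (fun z : R * R => h (fst z) (snd z))
       (within (fun z : R * R => 0 <= fst z /\ 0 <= snd z) (locally (u, v)))
       (locally (h u v))) /\
  (forall t : R, 0 <= t -> h t 0 = 0 /\ h 0 t = 0).

(* The Laplace transform of [h] at the complex point [(x, y)] is [l]: the
   iterated improper integral (in [u], then in [v]) converges to [l]. *)
Definition is_laplace (h : R -> R -> R) (x y l : C) : Prop :=
  exists I : R -> C,
    (forall v : R, 0 <= v ->
       is_RInt_gen (V := C_R_NormedModule)
         (fun u : R => (Cexp (- (u * x) - v * y) * h u v)%C)
         (at_point 0) (Rbar_locally p_infty) (I v)) /\
    is_RInt_gen (V := C_R_NormedModule) I
      (at_point 0) (Rbar_locally p_infty) l.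

(* [F] is the quotient [G / gamma] on the pairs of non-zero complex numbers.
   On the lines x = c_plus y and x = c_minus y, where [gamma] vanishes, the
   quotient is understood as its continuous extension; this is what gives a
   meaning to [F (c_plus y) y] and [F (c_minus y) y], including for those [y]
   at which the Laplace integral itself diverges. *)
Definition is_kernel_quotient (p : Z -> Z -> R) (G F : C -> C -> C) : Prop :=
  (forall x y : C, x <> 0 -> y <> 0 ->
     continuous (fun z : C * C => F (fst z) (snd z)) (x, y)) /\
  (forall x y : C, x <> 0 -> y <> 0 -> gamma p x y <> 0 ->
     F x y = (G x y / gamma p x y)%C).

Definition is_decoupling (p : Z -> Z -> R) (F : C -> C -> C) (f : C -> C)
    : Prop :=
  forall y : C, y <> 0 ->
    (f (c_plus p * y) - f (c_minus p * y) =
     F (c_plus p * y) y - F (c_minus p * y) y)%C.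

(* If [F (c_plus y) y] vanishes identically, every [m] is a degree of
   homogeneity; for the functions [F] used here, which satisfy
   F (conj x) (conj y) = conj (F x y), the conditions below then force
   [beta = 0] for each choice of [m]. *)
Definition is_monomial_decoupling (p : Z -> Z -> R) (F : C -> C -> C)
    (f : C -> C) : Prop :=
  exists (m : Z) (beta : C),
    (forall lambda y : C, lambda <> 0 -> y <> 0 ->
       F (c_plus p * (lambda * y)) (lambda * y) =
       CpowZ lambda m * F (c_plus p * y) y)%C /\
    (CpowZ (c_plus p) m = CpowZ (c_minus p) m -> beta = 0) /\
    (forall x : C, x <> 0 -> f x = (beta * CpowZ x m)%C) /\
    is_decoupling p F f.

(* [F n] is the function L(h_n^k) and [f n] its decoupling function, for
   n >= 1; [F 0] and [f 0] are irrelevant. *)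
Definition is_laplace_family (p : Z -> Z -> R) (N : Z) (k : nat)
    (F : nat -> C -> C -> C) (f : nat -> C -> C) : Prop :=
  is_kernel_quotient p
    (fun x y => omega_hat N x ^ k - omega_hat N (c_plus p * y) ^ k)%C (F 1%nat) /\
  (forall n : nat, (1 <= n)%nat ->
     is_monomial_decoupling p (F n) (f n) /\
     is_kernel_quotient p
       (fun x y => F n x y - f n x
                   - (F n (c_plus p * y) y - f n (c_plus p * y)))%C
       (F (S n))).

Definition is_homogeneous_polynomial (q : C -> C -> C) : Prop :=
  (exists (d : nat) (a : nat -> nat -> R), forall x y : C,
     q x y = sum_n (fun i => sum_n (fun j => a i j * x ^ i * y ^ j) d) d)%C /\
  (exists m : nat, forall lambda x y : C,
     q (lambda * x) (lambda * y) = lambda ^ m * q x y)%C.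

(* Main.v *)
(* After the linear change of variables z = r u + e^(i theta) v, with
   r = sqrt (sigma22 / sigma11), the operator [laplacian p] is a multiple of the
   Euclidean Laplacian and the quarter plane becomes a cone of opening
   theta = PI / N.  All the functions Im (z^(N k) |z|^(2 j)) are homogeneous
   polynomials vanishing on the boundary of the cone, and their real span is
   stable under solving Delta h' = h.  If h and h' are such polynomials with
   Delta h' = h, of degrees d and d + 2, integration by parts gives
     gamma L(h') = L(h) + P x^-(d+2) + Q y^-(d+2)
   with constants P and Q, so -P x^-(d+2) is a decoupling function of L(h).  When
   c_plus^(d+2) = c_minus^(d+2), the integer N divides d + 2, and the term in P is
   removed by adding to h' a multiple of the harmonic function Im z^(d+2).  Since
   the decoupling monomial is unique and the quotients by gamma are determined by
   continuity, every family of the theorem arises in this way. *)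

Require Import Defs.
From Stdlib Require Import Reals ZArith List.
From Stdlib Require Import Lra Lia Classical IndefiniteDescription.
From Stdlib Require Import FunctionalExtensionality.
From Coquelicot Require Import Coquelicot.
Open Scope R_scope.

(** * Covariances and the roots of the kernel *)

(** The recursion evaluates transforms on the lines [x = c_plus y] and [x = c_minus y] for every
    non-zero [y], where the Laplace integral may diverge. The algebra is therefore carried by
    [laplace_form], the rational function obtained by transforming a polynomial monomial by
    monomial. For it, integration by parts is a comparison of coefficients: multiplication by [x] or
    [y] shifts an index, and the two boundary terms are the coefficients pushed over the ends.
    Integrals return only at the end, for [x] and [y] of positive real part. The change of variables
    is not performed either. Products of powers of [z] and its conjugate are sequences of complex
    coefficients in [u] and [v], grown by one linear factor at a time, so that their Laplacian
    follows by induction from a Leibniz rule. Non-degeneracy enters through the positivity of the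
    covariance determinant, which keeps [theta] strictly between 0 and [PI] and the two kernel lines
    apart. *)

Lemma covariance_det_pos (p : Z -> Z -> R) :
  zero_drift_model p -> 0 < sigma11 p * sigma22 p - sigma12 p ^ 2.
Proof.
intros H.
assert (Hnn := zdm_nonneg p H).
assert (Hnd := zdm_non_degenerate p H).
(* One triple for each line through the origin: if all the weight of the neighbours sits on that
   line, the three entries of the triple vanish. *)
assert (H0 := Hnd 0%nat ltac:(lia)). assert (H1 := Hnd 1%nat ltac:(lia)).
assert (H2 := Hnd 2%nat ltac:(lia)). assert (H3 := Hnd 3%nat ltac:(lia)).
simpl in H0, H1, H2, H3.
assert (N1 := Hnn 1%Z 1%Z). assert (N2 := Hnn 1%Z 0%Z).
assert (N3 := Hnn 1%Z (-1)%Z). assert (N4 := Hnn 0%Z (-1)%Z).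
assert (N5 := Hnn (-1)%Z (-1)%Z). assert (N6 := Hnn (-1)%Z 0%Z).
assert (N7 := Hnn (-1)%Z 1%Z). assert (N8 := Hnn 0%Z 1%Z).
simpl in *.
generalize (N1 ltac:(tauto) ltac:(tauto)), (N2 ltac:(tauto) ltac:(tauto)),
  (N3 ltac:(tauto) ltac:(tauto)), (N4 ltac:(tauto) ltac:(tauto)),
  (N5 ltac:(tauto) ltac:(tauto)), (N6 ltac:(tauto) ltac:(tauto)),
  (N7 ltac:(tauto) ltac:(tauto)), (N8 ltac:(tauto) ltac:(tauto)).
unfold sigma11, sigma12, sigma22, step_sum, small; simpl.
clear - H0 H1 H2 H3.
revert H0 H1 H2 H3.
generalize (p 1%Z 1%Z) (p 1%Z 0%Z) (p 1%Z (-1)%Z) (p 0%Z (-1)%Z)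
  (p (-1)%Z (-1)%Z) (p (-1)%Z 0%Z) (p (-1)%Z 1%Z) (p 0%Z 1%Z).
intros a b c d a' b' c' d' H0 H1 H2 H3 Ha Hb Hc Hd Ha' Hb' Hc' Hd'.
(* Weights of opposite steps are grouped: the determinant is the sum over the
   pairs of distinct lines of the products of their weights, times the squared
   determinant of their directions. *)
match goal with |- 0 < ?e =>
  replace e with ((a + a') * (b + b') + (a + a') * (d + d')
    + (c + c') * (b + b') + (c + c') * (d + d') + (b + b') * (d + d')
    + 4 * ((a + a') * (c + c'))) by ring end.
assert (D : forall s t, 0 <= s -> 0 <= t -> s = 0 /\ t = 0 \/ 0 < s + t).
{ intros s t Hs Ht. destruct (Req_dec (s + t) 0); [left|right]; lra. }
assert (P : forall s t, 0 < s -> 0 < t -> 0 < s * t)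
  by (intros; apply Rmult_lt_0_compat; assumption).
assert (Q : forall s t, 0 <= s -> 0 <= t -> 0 <= s * t)
  by (intros; apply Rmult_le_pos; assumption).
assert (Q1 := Q (a+a') (b+b') ltac:(lra) ltac:(lra)).
assert (Q2 := Q (a+a') (d+d') ltac:(lra) ltac:(lra)).
assert (Q3 := Q (c+c') (b+b') ltac:(lra) ltac:(lra)).
assert (Q4 := Q (c+c') (d+d') ltac:(lra) ltac:(lra)).
assert (Q5 := Q (b+b') (d+d') ltac:(lra) ltac:(lra)).
assert (Q6 := Q (a+a') (c+c') ltac:(lra) ltac:(lra)).
destruct (D a a' Ha Ha') as [[Ea Ea']|Pa];
destruct (D b b' Hb Hb') as [[Eb Eb']|Pb];
destruct (D c c' Hc Hc') as [[Ec Ec']|Pc];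
destruct (D d d' Hd Hd') as [[Ed Ed']|Pd]; try tauto;
first [ pose proof (P _ _ Pa Pb); lra | pose proof (P _ _ Pa Pc); lra
      | pose proof (P _ _ Pa Pd); lra | pose proof (P _ _ Pb Pc); lra
      | pose proof (P _ _ Pb Pd); lra | pose proof (P _ _ Pc Pd); lra ].
Qed.

Lemma sigma11_pos (p : Z -> Z -> R) : zero_drift_model p -> 0 < sigma11 p.
Proof.
intros H. pose proof (covariance_det_pos p H).
assert (0 <= sigma11 p).
{ unfold sigma11, step_sum, small; simpl.
  assert (Hnn := zdm_nonneg p H). unfold small in Hnn; simpl in Hnn.
  repeat match goal with |- context [p ?i ?j] =>
    let h := fresh in assert (h := Hnn i j ltac:(tauto) ltac:(tauto));
    revert h; generalize (p i j); intros end; lra. }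
destruct (Req_dec (sigma11 p) 0) as [E|E]; [rewrite E in *; nra | lra].
Qed.

Lemma sigma22_pos (p : Z -> Z -> R) : zero_drift_model p -> 0 < sigma22 p.
Proof.
intros H. pose proof (covariance_det_pos p H). pose proof (sigma11_pos p H). nra.
Qed.

Definition root_ratio (p : Z -> Z -> R) : R := sqrt (sigma22 p / sigma11 p).

Lemma root_ratio_pos (p : Z -> Z -> R) : zero_drift_model p -> 0 < root_ratio p.
Proof.
intros H. apply sqrt_lt_R0, Rdiv_lt_0_compat;
  [apply sigma22_pos | apply sigma11_pos]; exact H.
Qed.

Lemma root_ratio_sqr (p : Z -> Z -> R) :
  zero_drift_model p -> sigma11 p * root_ratio p ^ 2 = sigma22 p.
Proof.
intros H. pose proof (sigma11_pos p H). pose proof (sigma22_pos p H).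
unfold root_ratio. rewrite pow2_sqrt; [field; lra|].
apply Rlt_le, Rdiv_lt_0_compat; assumption.
Qed.

(** Positivity of the determinant is a strict Cauchy-Schwarz inequality, so the argument of [acos]
    lies strictly inside (-1, 1). The identity for the cosine rests on [sqrt (sigma11 * sigma22) =
    sigma11 * root_ratio]. *)
Lemma theta_spec (p : Z -> Z -> R) : zero_drift_model p ->
  0 < theta p < PI /\ sigma11 p * root_ratio p * cos (theta p) = - sigma12 p.
Proof.
intros H. pose proof (sigma11_pos p H). pose proof (sigma22_pos p H).
pose proof (covariance_det_pos p H). pose proof (root_ratio_pos p H).
set (s := sqrt (sigma11 p * sigma22 p)).
assert (Hs : 0 < s) by (apply sqrt_lt_R0, Rmult_lt_0_compat; assumption).
assert (Hs2 : s ^ 2 = sigma11 p * sigma22 p)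
  by (apply pow2_sqrt, Rlt_le, Rmult_lt_0_compat; assumption).
assert (Hsr : s = sigma11 p * root_ratio p).
{ apply Rsqr_inj; try apply Rlt_le; auto; try (apply Rmult_lt_0_compat; auto).
  unfold Rsqr. pose proof (root_ratio_sqr p H). nra. }
assert (Hb : -1 < - sigma12 p / s < 1).
{ split; apply Rmult_lt_reg_r with s; auto; unfold Rdiv;
  rewrite Rmult_assoc, Rinv_l, Rmult_1_r by lra; nra. }
unfold theta; fold s. split.
- apply acos_bound_lt; exact Hb.
- rewrite cos_acos by lra. rewrite <- Hsr. field; lra.
Qed.

(** As [theta < PI], the quotient exceeds 1. The bound 2 ensures later that the degrees [N k] are at
    least 2, so that the Laplacian lowers them by 2 without truncation. *)
Lemma theta_integer (p : Z -> Z -> R) (N : Z) : zero_drift_model p ->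
  PI / theta p = IZR N -> (2 <= N)%Z /\ IZR N * theta p = PI.
Proof.
intros H E. destruct (theta_spec p H) as [[T1 T2] _].
assert (E' : IZR N * theta p = PI) by (rewrite <- E; field; lra).
split; [|exact E'].
assert (1 < N)%Z; [|lia]. apply lt_IZR. nra.
Qed.

Lemma sin_theta_pos (p : Z -> Z -> R) : zero_drift_model p -> 0 < sin (theta p).
Proof. intros H. destruct (theta_spec p H). apply sin_gt_0; lra. Qed.

Definition unit_root (p : Z -> Z -> R) : C := (cos (theta p), sin (theta p)).

Lemma c_plus_eq (p : Z -> Z -> R) : c_plus p = (root_ratio p * unit_root p)%C.
Proof.
unfold c_plus, unit_root. fold (root_ratio p). f_equal.
unfold Cexp, Ci, RtoC; simpl.
replace (0 * theta p - 1 * 0) with 0 by ring.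
replace (0 * 0 + 1 * theta p) with (theta p) by ring.
rewrite exp_0; f_equal; ring.
Qed.

Lemma c_minus_eq (p : Z -> Z -> R) : c_minus p = Cconj (c_plus p).
Proof.
rewrite c_plus_eq, Cmult_conj. unfold c_minus, unit_root. fold (root_ratio p).
unfold Cexp, Ci, RtoC, Cconj, Cmult; simpl.
replace (-(0 * theta p - 1 * 0)) with 0 by ring.
replace (- (0 * 0 + 1 * theta p)) with (- theta p) by ring.
rewrite exp_0, cos_neg, sin_neg; f_equal; ring.
Qed.

Lemma unit_root_pow (p : Z -> Z -> R) (n : nat) :
  (unit_root p ^ n)%C = (cos (INR n * theta p), sin (INR n * theta p)).
Proof.
induction n as [|n IH].
- simpl. rewrite Rmult_0_l, cos_0, sin_0. reflexivity.
- rewrite Cpow_S, IH, S_INR, Rmult_plus_distr_r, Rmult_1_l, cos_plus, sin_plus.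
  unfold unit_root, Cmult; simpl. f_equal; ring.
Qed.

Lemma c_plus_neq0 (p : Z -> Z -> R) : zero_drift_model p -> c_plus p <> 0.
Proof.
intros H E. rewrite c_plus_eq in E. apply (f_equal Im) in E. revert E.
unfold unit_root; simpl. pose proof (root_ratio_pos p H).
pose proof (sin_theta_pos p H). nra.
Qed.

Lemma c_minus_neq0 (p : Z -> Z -> R) : zero_drift_model p -> c_minus p <> 0.
Proof.
intros H E. apply (c_plus_neq0 p H).
rewrite <- (Cconj_conj (c_plus p)), <- c_minus_eq, E.
unfold Cconj, RtoC; simpl; f_equal; ring.
Qed.

(** Vieta: [c_plus] and [c_minus] have the sum and the product of the roots of the kernel in
    [x / y]. *)
Lemma gamma_factor (p : Z -> Z -> R) (x y : C) : zero_drift_model p ->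
  gamma p x y = (sigma11 p / 2 * (x - c_plus p * y) * (x - c_minus p * y))%C.
Proof.
intros H. unfold gamma.
destruct (theta_spec p H) as [_ T]. pose proof (root_ratio_sqr p H) as R2.
assert (E1 : (sigma11 p * (c_plus p + c_minus p))%C = (- (2 * sigma12 p))%R).
{ rewrite c_minus_eq, c_plus_eq. unfold unit_root, Cmult, Cplus, Cconj, RtoC; simpl.
  f_equal; [|ring]. transitivity (2 * (sigma11 p * root_ratio p * cos (theta p))); [ring|].
  rewrite T; ring. }
assert (E2 : (sigma11 p * (c_plus p * c_minus p))%C = sigma22 p).
{ rewrite c_minus_eq, c_plus_eq. unfold unit_root, Cmult, Cplus, Cconj, RtoC; simpl.
  f_equal; [|ring].
  transitivity (sigma11 p * root_ratio p ^ 2 * (Rsqr (sin (theta p)) + Rsqr (cos (theta p))));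
    [unfold Rsqr; ring|]. rewrite sin2_cos2, R2; ring. }
rewrite RtoC_opp, RtoC_mult in E1.
assert (E3 : (2 * sigma12 p)%C = (- (sigma11 p * (c_plus p + c_minus p)))%C)
  by (rewrite E1; ring).
rewrite E3, <- E2. unfold Cdiv. ring.
Qed.

(** * Polynomials vanishing on the boundary of the cone *)

(** The coefficient of [u^i v^(d-2-i)] in the Laplacian of the form of degree [d] with coefficients
    [a]. *)
Definition lap_coef (p : Z -> Z -> R) (d : R) (a : nat -> R) (i : nat) : R :=
  / 2 * (sigma11 p * ((INR i + 2) * (INR i + 1)) * a (S (S i))
         + 2 * sigma12 p * ((INR i + 1) * (d - INR i - 1)) * a (S i)
         + sigma22 p * ((d - INR i) * (d - INR i - 1)) * a i).

(* A sequence [w] stands for the form [sum_i (w i) u^i v^(d-i)].  Degrees enter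
   as real numbers, which avoids truncated subtractions. *)
Definition lin_mul (r e : C) (w : nat -> C) (i : nat) : C :=
  (match i with O => 0 | S j => r * w j end + e * w i)%C.

Definition lapC (p : Z -> Z -> R) (d : R) (w : nat -> C) (i : nat) : C :=
  (/ 2 * (sigma11 p * ((INR i + 2) * (INR i + 1)) * w (S (S i))
         + 2 * sigma12 p * ((INR i + 1) * (d - INR i - 1)) * w (S i)
         + sigma22 p * ((d - INR i) * (d - INR i - 1)) * w i))%C.

(* The derivative in the direction dual to the linear form [r u + e v]. *)
Definition dir_deriv (p : Z -> Z -> R) (r e : C) (d : R) (w : nat -> C)
    (i : nat) : C :=
  ((sigma11 p * r + sigma12 p * e) * ((INR i + 1) * w (S i))
   + (sigma12 p * r + sigma22 p * e) * ((d - INR i) * w i))%C.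

(** The covariance bilinear form on the pair of linear forms [r u + e v] and [r u + e' v]. *)
Definition dual_form (p : Z -> Z -> R) (r e e' : C) : C :=
  ((sigma11 p * r + sigma12 p * e) * r + (sigma12 p * r + sigma22 p * e) * e')%C.

(** Leibniz rule: the second derivatives of a linear factor vanish, which leaves only the cross
    term. *)
Lemma lapC_lin_mul (p : Z -> Z -> R) (r e : C) (d : R) (w : nat -> C) (i : nat) :
  lapC p (d + 1) (lin_mul r e w) i =
  (lin_mul r e (lapC p d w) i + dir_deriv p r e d w i)%C.
Proof.
unfold lapC, lin_mul, dir_deriv.
destruct i as [|i]; rewrite ?S_INR; simpl INR; rewrite ?RtoC_plus; field;
  intros E; apply RtoC_inj in E; lra.
Qed.

Lemma dir_deriv_lin_mul (p : Z -> Z -> R) (r e e' : C) (d : R) (w : nat -> C)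
    (i : nat) :
  dir_deriv p r e (d + 1) (lin_mul r e' w) i =
  (lin_mul r e' (dir_deriv p r e d w) i + dual_form p r e e' * w i)%C.
Proof.
unfold lin_mul, dir_deriv, dual_form.
destruct i as [|i]; rewrite ?S_INR; simpl INR; rewrite ?RtoC_plus; ring.
Qed.

(** The coefficients of [(r u + e v)^a (r u + e' v)^b], a form of degree [a + b]. *)
Definition lin_pow (r e e' : C) (a b : nat) : nat -> C :=
  Nat.iter a (lin_mul r e)
    (Nat.iter b (lin_mul r e') (fun i => match i with O => 1 | _ => 0 end)%C).

Lemma lin_mul_scal (r e s : C) (w w' : nat -> C) :
  (forall i, w i = s * w' i)%C ->
  forall i, (lin_mul r e w i = s * lin_mul r e w' i)%C.
Proof.
intros H i; unfold lin_mul; destruct i; rewrite !H; ring.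
Qed.

Section LinPow.
Variables (p : Z -> Z -> R) (r e e' : C).
Hypothesis (iso : dual_form p r e e = 0) (iso' : dual_form p r e' e' = 0).
Let K := dual_form p r e e'.
Let w := lin_pow r e e'.

(** An isotropic linear form is annihilated by its own dual derivative, hence so are its powers. *)
Lemma dir_deriv_lin_pow_r (b i : nat) : dir_deriv p r e' (INR b) (w 0 b) i = 0.
Proof.
revert i; induction b as [|b IH]; intros i.
- unfold dir_deriv, w, lin_pow; destruct i; simpl; ring.
- rewrite S_INR. change (w 0 (S b)) with (lin_mul r e' (w 0 b)).
  rewrite dir_deriv_lin_mul, iso'.
  rewrite (lin_mul_scal r e' 0 _ (w 0 b)); [ring|].
  intros j; rewrite IH; ring.
Qed.

Lemma dir_deriv_lin_pow (a b i : nat) :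
  dir_deriv p r e (INR (a + b)) (w a b) i = (INR b * K * w a (pred b) i)%C.
Proof.
revert i; induction a as [|a IH]; intros i.
- change (0 + b)%nat with b. revert i; induction b as [|b IH]; intros i.
  + unfold dir_deriv, w, lin_pow; destruct i; simpl; ring.
  + rewrite S_INR at 1. change (w 0 (S b)) with (lin_mul r e' (w 0 b)).
    rewrite dir_deriv_lin_mul. fold K.
    rewrite (lin_mul_scal r e' _ _ _ IH). rewrite S_INR, RtoC_plus.
    destruct b as [|b]; [simpl; ring|].
    change (lin_mul r e' (w 0 (pred (S b)))) with (w 0 (S b)). simpl pred. ring.
- change (S a + b)%nat with (S (a + b)). rewrite S_INR.
  change (w (S a) b) with (lin_mul r e (w a b)).
  rewrite dir_deriv_lin_mul, iso, (lin_mul_scal r e _ _ _ IH).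
  change (w (S a) (pred b)) with (lin_mul r e (w a (pred b))). ring.
Qed.

(** With two isotropic linear forms as coordinates, the Laplacian is [K] times the mixed derivative.
    When [a] or [b] is 0, the factor [INR a] or [INR b] cancels the spurious value of [pred]. *)
Lemma lapC_lin_pow (a b i : nat) :
  lapC p (INR (a + b)) (w a b) i =
  (INR a * INR b * K * w (pred a) (pred b) i)%C.
Proof.
revert i; induction a as [|a IH]; intros i.
- change (0 + b)%nat with b. revert i; induction b as [|b IH]; intros i.
  + unfold lapC, w, lin_pow; destruct i; simpl; ring.
  + rewrite S_INR at 1. change (w 0 (S b)) with (lin_mul r e' (w 0 b)).
    rewrite lapC_lin_mul, dir_deriv_lin_pow_r.
    rewrite (lin_mul_scal r e' 0 _ (w 0 b)); [simpl; ring|].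
    intros j; rewrite IH; simpl; ring.
- change (S a + b)%nat with (S (a + b)). rewrite S_INR at 1.
  change (w (S a) b) with (lin_mul r e (w a b)).
  rewrite lapC_lin_mul, dir_deriv_lin_pow, (lin_mul_scal r e _ _ _ IH).
  rewrite S_INR, RtoC_plus.
  destruct a as [|a]; [simpl; ring|].
  change (lin_mul r e (w (pred (S a)) (pred b))) with (w (S a) (pred b)).
  simpl pred. ring.
Qed.

End LinPow.

Lemma lin_pow_at_0 (r e e' : C) (a b : nat) :
  lin_pow r e e' a b 0 = (e ^ a * e' ^ b)%C.
Proof.
induction a as [|a IH]; [induction b as [|b IH]|].
- unfold lin_pow; simpl; ring.
- change (lin_pow r e e' 0 (S b)) with (lin_mul r e' (lin_pow r e e' 0 b)).
  unfold lin_mul; rewrite IH; simpl; ring.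
- change (lin_pow r e e' (S a) b) with (lin_mul r e (lin_pow r e e' a b)).
  unfold lin_mul; rewrite IH; simpl; ring.
Qed.

Lemma lin_mul_top (r e : C) (w : nat -> C) (d : nat) (s : C) :
  (forall i, (d < i)%nat -> w i = 0) -> w d = s ->
  (forall i, (S d < i)%nat -> lin_mul r e w i = 0) /\
  lin_mul r e w (S d) = (r * s)%C.
Proof.
intros H E; split.
- intros [|i] Hi; [lia|]. unfold lin_mul. rewrite !H by lia. ring.
- unfold lin_mul. rewrite E, H by lia. ring.
Qed.

Lemma lin_pow_top (r e e' : C) (a b : nat) :
  (forall i, (a + b < i)%nat -> lin_pow r e e' a b i = 0) /\
  lin_pow r e e' a b (a + b) = (r ^ (a + b))%C.
Proof.
induction a as [|a IH]; [induction b as [|b IH]|].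
- split; [|reflexivity]. intros [|i] Hi; [lia|reflexivity].
- change (lin_pow r e e' 0 (S b)) with (lin_mul r e' (lin_pow r e e' 0 b)).
  apply lin_mul_top; apply IH.
- change (lin_pow r e e' (S a) b) with (lin_mul r e (lin_pow r e e' a b)).
  apply lin_mul_top; apply IH.
Qed.

Lemma lin_pow_subtop (r e e' : C) (a : nat) :
  lin_pow r e e' (S a) 0 a = (INR (S a) * r ^ a * e)%C.
Proof.
induction a as [|a IH].
- unfold lin_pow; simpl. unfold lin_mul. ring.
- change (lin_pow r e e' (S (S a)) 0)
    with (lin_mul r e (lin_pow r e e' (S a) 0)).
  unfold lin_mul. rewrite IH.
  destruct (lin_pow_top r e e' (S a) 0) as [_ T].
  rewrite Nat.add_0_r in T. rewrite T, (S_INR (S a)), RtoC_plus. simpl Cpow. ring.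
Qed.

Lemma Im_lapC (p : Z -> Z -> R) (d : R) (w : nat -> C) (i : nat) :
  Im (lapC p d w i) = lap_coef p d (fun j => Im (w j)) i.
Proof.
unfold lapC, lap_coef.
destruct (w i), (w (S i)), (w (S (S i))).
rewrite <- RtoC_inv by lra. unfold RtoC, Cmult, Cplus, Copp, Cminus; simpl.
field.
Qed.

Lemma Im_mult_RtoC (s : R) (z : C) : Im (s * z)%C = s * Im z.
Proof. destruct z; unfold Cmult, RtoC; simpl; ring. Qed.

(** From [sigma11 r^2 = sigma22] and [sigma12 r = - sigma22 cos theta], the form equals
    [2 sigma22 (1 - cos^2 theta)]. Being real, it commutes with taking imaginary parts; being
    non-zero, it can be divided by when the Laplacian is inverted. *)
Lemma dual_form_real (p : Z -> Z -> R) : zero_drift_model p ->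
  exists K : R, K <> 0 /\
    dual_form p (root_ratio p) (unit_root p) (Cconj (unit_root p)) = K.
Proof.
intros H. exists (2 * (sigma22 p * sin (theta p) ^ 2)). split.
- pose proof (sigma22_pos p H). pose proof (sin_theta_pos p H).
  apply Rgt_not_eq. apply Rmult_lt_0_compat; [lra|].
  apply Rmult_lt_0_compat; [|apply pow_lt]; assumption.
- destruct (theta_spec p H) as [_ T]. pose proof (root_ratio_sqr p H) as R2.
  assert (S2 := sin2_cos2 (theta p)). unfold Rsqr in S2.
  assert (T' : sigma12 p * root_ratio p = - (sigma22 p * cos (theta p))).
  { rewrite <- R2. replace (sigma12 p)
      with (- (sigma11 p * root_ratio p * cos (theta p))) by lra. ring. }
  unfold dual_form, unit_root, Cconj, Cmult, Cplus, RtoC; simpl. f_equal; [|ring].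
  transitivity (sigma11 p * root_ratio p ^ 2
    + 2 * (sigma12 p * root_ratio p) * cos (theta p)
    + sigma22 p * (sin (theta p) * sin (theta p) + cos (theta p) * cos (theta p)));
    [ring|].
  rewrite R2, T', S2.
  replace (sigma22 p) with (sigma22 p * (sin (theta p) * sin (theta p)
    + cos (theta p) * cos (theta p))) at 1 3 by (rewrite S2; ring). ring.
Qed.

(** Up to the factor [sigma22] this is the equation [e^2 - 2 cos(theta) e + 1 = 0] satisfied by
    [e = unit_root p]. *)
Lemma dual_form_isotropic (p : Z -> Z -> R) : zero_drift_model p ->
  dual_form p (root_ratio p) (unit_root p) (unit_root p) = 0.
Proof.
intros H.
destruct (theta_spec p H) as [_ T]. pose proof (root_ratio_sqr p H) as R2.
assert (S2 := sin2_cos2 (theta p)). unfold Rsqr in S2.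
assert (T' : sigma12 p * root_ratio p = - (sigma22 p * cos (theta p))).
{ rewrite <- R2. replace (sigma12 p)
    with (- (sigma11 p * root_ratio p * cos (theta p))) by lra. ring. }
unfold dual_form, unit_root, Cmult, Cplus, RtoC; simpl. f_equal.
- transitivity (sigma11 p * root_ratio p ^ 2
    + 2 * (sigma12 p * root_ratio p) * cos (theta p)
    + sigma22 p * (cos (theta p) * cos (theta p) - sin (theta p) * sin (theta p)));
    [ring|].
  rewrite R2, T'.
  replace (sigma22 p) with (sigma22 p * (sin (theta p) * sin (theta p)
    + cos (theta p) * cos (theta p))) at 1 by (rewrite S2; ring). ring.
- transitivity (2 * (sigma12 p * root_ratio p) * sin (theta p)
    + 2 * sigma22 p * sin (theta p) * cos (theta p)); [ring|].
  rewrite T'. ring.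
Qed.

Lemma dual_form_conj (p : Z -> Z -> R) (r : R) (e e' : C) :
  dual_form p r (Cconj e) (Cconj e') = Cconj (dual_form p r e e').
Proof.
destruct e, e'. unfold dual_form, Cconj, Cmult, Cplus, RtoC; simpl. f_equal; ring.
Qed.

(* Coefficients of [Im (z^M |z|^(2j))], where [z = r u + e^(i theta) v] maps the
   quarter plane onto the cone of opening [theta] and turns [laplacian p] into a
   multiple of the Euclidean Laplacian. *)
Definition wedge_coef (p : Z -> Z -> R) (M j : nat) (i : nat) : R :=
  Im (lin_pow (root_ratio p) (unit_root p) (Cconj (unit_root p)) (M + j) j i).

Lemma lap_wedge_coef (p : Z -> Z -> R) : zero_drift_model p ->
  exists K : R, K <> 0 /\ forall M j i : nat,
    lap_coef p (INR (M + 2 * j)) (wedge_coef p M j) i =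
    INR (M + j) * INR j * K * wedge_coef p M (pred j) i.
Proof.
intros H. destruct (dual_form_real p H) as [K [HK EK]].
exists K; split; [exact HK|]. intros M j i.
unfold wedge_coef at 1. rewrite <- Im_lapC.
replace (M + 2 * j)%nat with ((M + j) + j)%nat by lia.
rewrite lapC_lin_pow.
- rewrite EK, <- !RtoC_mult, Im_mult_RtoC. unfold wedge_coef.
  destruct j as [|j]; [simpl; ring|].
  replace (pred (M + S j)) with (M + pred (S j))%nat by (simpl; lia). reflexivity.
- apply dual_form_isotropic, H.
- rewrite dual_form_conj, dual_form_isotropic by exact H.
  unfold Cconj, RtoC; simpl; f_equal; ring.
Qed.

(** The two end coefficients are the values on the axes: [z] is real for [v = 0], and for [u = 0] it
    is [e^(i theta) v], which contributes [sin (M theta)]. *)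
Lemma wedge_coef_boundary (p : Z -> Z -> R) (M j : nat) : zero_drift_model p ->
  sin (INR M * theta p) = 0 ->
  wedge_coef p M j 0 = 0 /\ wedge_coef p M j (M + 2 * j) = 0.
Proof.
intros H HM. unfold wedge_coef. split.
- rewrite lin_pow_at_0, Cpow_add_r, <- Cmult_assoc, <- Cpow_mult_l.
  replace (unit_root p * Cconj (unit_root p))%C with (RtoC 1).
  + rewrite Cpow_1_l, unit_root_pow, HM. unfold Cmult, RtoC; simpl; ring.
  + assert (S2 := sin2_cos2 (theta p)). unfold Rsqr in S2.
    unfold unit_root, Cconj, Cmult, RtoC; simpl. f_equal; nra.
- replace (M + 2 * j)%nat with ((M + j) + j)%nat by lia.
  destruct (lin_pow_top (root_ratio p) (unit_root p) (Cconj (unit_root p)) (M + j) j)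
    as [_ T]. rewrite T, <- RtoC_pow. reflexivity.
Qed.

(** The coefficient of [u^a v] in [Im (z^(a+1))] is [(a+1) r^a sin theta]. It determines the
    boundary constant in [x] of a harmonic polynomial, which must be invertible. *)
Lemma wedge_coef_subtop (p : Z -> Z -> R) (a : nat) : zero_drift_model p ->
  wedge_coef p (S a) 0 a <> 0.
Proof.
intros H. unfold wedge_coef. rewrite Nat.add_0_r, lin_pow_subtop.
rewrite <- RtoC_pow, <- RtoC_mult, Im_mult_RtoC. simpl (Im (unit_root p)).
pose proof (root_ratio_pos p H). pose proof (sin_theta_pos p H).
apply Rgt_not_eq. repeat apply Rmult_lt_0_compat; auto.
- apply lt_0_INR; lia.
- apply pow_lt; auto.
Qed.

Inductive wedge_span (p : Z -> Z -> R) (N d : nat) : (nat -> R) -> Prop :=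
| wedge_span_zero : wedge_span p N d (fun _ => 0)
| wedge_span_add (k j : nat) (t : R) (a : nat -> R) :
    (1 <= k)%nat -> d = (N * k + 2 * j)%nat -> wedge_span p N d a ->
    wedge_span p N d (fun i => t * wedge_coef p (N * k) j i + a i).

(** Solved term by term: replacing [j] by [j + 1] multiplies the Laplacian by the non-zero constant
    [s], by which the coefficient [t] is divided. *)
Lemma wedge_span_solve (p : Z -> Z -> R) (N d : nat) (a : nat -> R) :
  zero_drift_model p -> (1 <= N)%nat -> wedge_span p N d a ->
  exists a', wedge_span p N (S (S d)) a' /\
    forall i, lap_coef p (INR (S (S d))) a' i = a i.
Proof.
intros H HN Ha. induction Ha as [|k j t a Hk Hd Ha [a' [IH1 IH2]]].
- exists (fun _ => 0). split; [constructor|]. intros i; unfold lap_coef; ring.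
- destruct (lap_wedge_coef p H) as [K [HK EK]].
  assert (P1 : 0 < INR (N * k + S j)) by (apply lt_0_INR; nia).
  assert (P2 : 0 < INR (S j)) by (apply lt_0_INR; nia).
  set (s := INR (N * k + S j) * INR (S j) * K).
  assert (Hs : s <> 0) by (unfold s; repeat apply Rmult_integral_contrapositive_currified;
    first [assumption | apply Rgt_not_eq; assumption]).
  exists (fun i => t / s * wedge_coef p (N * k) (S j) i + a' i). split.
  + constructor; [assumption| lia |assumption].
  + intros i. rewrite <- IH2.
    assert (E := EK (N * k)%nat (S j) i). simpl pred in E. fold s in E.
    replace (N * k + 2 * S j)%nat with (S (S d)) in E by lia.
    replace (t * wedge_coef p (N * k) j i)
      with (t / s * lap_coef p (INR (S (S d))) (wedge_coef p (N * k) (S j)) i)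
      by (rewrite E; field; exact Hs).
    unfold lap_coef; ring.
Qed.

Lemma sin_multiple (p : Z -> Z -> R) (N k : nat) :
  INR N * theta p = PI -> sin (INR (N * k) * theta p) = 0.
Proof.
intros E. apply sin_eq_0_1. exists (Z.of_nat k).
rewrite mult_INR, <- INR_IZR_INZ, <- E. ring.
Qed.

Lemma wedge_span_boundary (p : Z -> Z -> R) (N d : nat) (a : nat -> R) :
  zero_drift_model p -> INR N * theta p = PI -> wedge_span p N d a ->
  a 0%nat = 0 /\ a d = 0.
Proof.
intros H HN Ha. induction Ha as [|k j t a Hk Hd Ha [IH1 IH2]]; [split; reflexivity|].
destruct (wedge_coef_boundary p (N * k) j H (sin_multiple p N k HN)) as [B1 B2].
rewrite <- Hd in B2. rewrite B1, B2, IH1, IH2. split; ring.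
Qed.

(** * Formal Laplace transforms *)

(* Sums over [C] are typed in the carrier of an abelian monoid, which [ring] does
   not see through. *)
Ltac cring := match goal with |- @eq _ ?a ?b => change (@eq C a b) end; ring.

Lemma Csum_Sn (f : nat -> C) (n : nat) :
  sum_n f (S n) = (sum_n f n + f (S n))%C.
Proof. exact (sum_Sn f n). Qed.

Lemma Csum_shift (f : nat -> C) (n : nat) :
  sum_n f (S n) = (f 0%nat + sum_n (fun i => f (S i)) n)%C.
Proof.
induction n as [|n IH].
- rewrite Csum_Sn, !sum_O. reflexivity.
- rewrite Csum_Sn, IH, Csum_Sn. cring.
Qed.

Lemma Csum_mult_l (k : C) (f : nat -> C) (n : nat) :
  sum_n (fun i => k * f i)%C n = (k * sum_n f n)%C.
Proof.
induction n as [|n IH]; [rewrite !sum_O; reflexivity|].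
rewrite !Csum_Sn, IH. cring.
Qed.

Lemma Csum_plus (f g : nat -> C) (n : nat) :
  sum_n (fun i => f i + g i)%C n = (sum_n f n + sum_n g n)%C.
Proof.
induction n as [|n IH]; [rewrite !sum_O; reflexivity|].
rewrite !Csum_Sn, IH. cring.
Qed.

Lemma Csum_conj (f : nat -> C) (n : nat) :
  Cconj (sum_n f n) = sum_n (fun i => Cconj (f i)) n.
Proof.
induction n as [|n IH]; [rewrite !sum_O; reflexivity|].
rewrite !Csum_Sn, Cplus_conj, IH. reflexivity.
Qed.

Lemma Csum_ext (f g : nat -> C) (n : nat) :
  (forall i, (i <= n)%nat -> f i = g i) -> sum_n f n = sum_n g n.
Proof. exact (sum_n_ext_loc f g n). Qed.

Definition form (a : nat -> R) (d : nat) (u v : R) : R :=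
  sum_n (fun i => a i * u ^ i * v ^ (d - i)) d.

(** The factorials come from the transform of [u^i v^j], which is [i! j! x^-(i+1) y^-(j+1)]. *)
Definition scaled (a : nat -> R) (d i : nat) : R :=
  a i * (INR (fact i) * INR (fact (d - i))).

Definition laplace_form (a : nat -> R) (d : nat) (x y : C) : C :=
  sum_n (fun i => scaled a d i * (/ x) ^ S i * (/ y) ^ S (d - i))%C d.

(** The factorials absorb the factors produced by differentiation, so the Laplacian becomes a
    combination of index shifts with the coefficients of the kernel. *)
Lemma scaled_lap_coef (p : Z -> Z -> R) (a : nat -> R) (e i : nat) : (i <= e)%nat ->
  scaled (lap_coef p (INR (S (S e))) a) e i =
  / 2 * (sigma11 p * scaled a (S (S e)) (S (S i))
         + 2 * sigma12 p * scaled a (S (S e)) (S i)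
         + sigma22 p * scaled a (S (S e)) i).
Proof.
intros Hi. unfold scaled, lap_coef.
replace (S (S e) - S (S i))%nat with (e - i)%nat by lia.
replace (S (S e) - S i)%nat with (S (e - i)) by lia.
replace (S (S e) - i)%nat with (S (S (e - i))) by lia.
rewrite !fact_simpl, !mult_INR, !S_INR, minus_INR by exact Hi.
field.
Qed.

(** Multiplying by [x^2], [x y] and [y^2] shifts the exponents of the monomials. The vanishing end
    coefficients remove all terms that leave the range, except the one with index 1 under [x^2] and
    the one with index [S e] under [y^2]: these are the pure powers of [/ y] and [/ x]. *)
Lemma gamma_laplace_form (p : Z -> Z -> R) (a : nat -> R) (e : nat) (x y : C) :
  x <> 0 -> y <> 0 -> a 0%nat = 0 -> a (S (S e)) = 0 ->
  (gamma p x y * laplace_form a (S (S e)) x y =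
   laplace_form (lap_coef p (INR (S (S e))) a) e x y
   + (/ 2 * sigma22 p * scaled a (S (S e)) (S e))%R * (/ x) ^ S (S e)
   + (/ 2 * sigma11 p * scaled a (S (S e)) 1)%R * (/ y) ^ S (S e))%C.
Proof.
intros Hx Hy H0 Hd.
set (d := S (S e)). set (A := scaled a d).
assert (A0 : A 0%nat = 0) by (unfold A, scaled; rewrite H0; ring).
assert (Ad : A d = 0) by (unfold A, scaled, d; rewrite Hd; ring).
set (X := (/ x)%C). set (Y := (/ y)%C).
assert (HX : (x * X)%C = 1) by (unfold X; field; exact Hx).
assert (HY : (y * Y)%C = 1) by (unfold Y; field; exact Hy).
assert (E1 : (x ^ 2 * laplace_form a d x y =
  A 1%nat * Y ^ d + sum_n (fun i => A (S (S i)) * X ^ S i * Y ^ S (e - i)) e)%C).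
{ unfold laplace_form. fold A X Y. unfold d at 2.
  rewrite !Csum_shift, A0.
  rewrite (Cmult_plus_distr_l (x ^ 2)), (Cmult_plus_distr_l (x ^ 2)).
  rewrite <- Csum_mult_l. rewrite Cplus_assoc. f_equal.
  - unfold d; simpl Nat.sub. transitivity ((x * X) * (x * X) * A 1%nat * Y ^ S (S e))%C.
    + simpl; cring. + rewrite HX; cring.
  - apply Csum_ext; intros i Hi.
    replace (d - S (S i))%nat with (e - i)%nat by (unfold d; lia).
    transitivity ((x * X) * (x * X) * (A (S (S i)) * X ^ S i * Y ^ S (e - i)))%C.
    + rewrite !(Cpow_S X). simpl (x ^ 2)%C. cring. + rewrite HX; cring. }
assert (E3 : (y ^ 2 * laplace_form a d x y =
  A (S e) * X ^ d + sum_n (fun i => A i * X ^ S i * Y ^ S (e - i)) e)%C).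
{ unfold laplace_form. fold A X Y. unfold d at 2.
  rewrite !Csum_Sn. fold d. rewrite Ad.
  rewrite (Cmult_plus_distr_l (y ^ 2)), (Cmult_plus_distr_l (y ^ 2)).
  rewrite <- Csum_mult_l.
  assert (B1 : (y ^ 2 * (A (S e) * X ^ d * Y ^ S (d - S e)) = A (S e) * X ^ d)%C).
  { replace (d - S e)%nat with 1%nat by (unfold d; lia).
    transitivity ((y * Y) * (y * Y) * A (S e) * X ^ d)%C.
    + simpl; cring. + rewrite HY; cring. }
  rewrite B1.
  rewrite (Csum_ext _ (fun i => A i * X ^ S i * Y ^ S (e - i))%C); [cring|].
  intros i Hi. replace (d - i)%nat with (S (S (e - i)))%nat by (unfold d; lia).
  transitivity ((y * Y) * (y * Y) * (A i * X ^ S i * Y ^ S (e - i)))%C.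
  + rewrite !(Cpow_S Y). simpl (y ^ 2)%C. cring. + rewrite HY; cring. }
assert (E2 : (x * y * laplace_form a d x y =
  sum_n (fun i => A (S i) * X ^ S i * Y ^ S (e - i)) e)%C).
{ unfold laplace_form. fold A X Y. unfold d at 2.
  rewrite Csum_shift, Csum_Sn. fold d. rewrite Ad, A0.
  rewrite (Cmult_plus_distr_l (x * y)), (Cmult_plus_distr_l (x * y)).
  rewrite <- Csum_mult_l.
  rewrite (Csum_ext _ (fun i => A (S i) * X ^ S i * Y ^ S (e - i))%C); [cring|].
  intros i Hi. replace (d - S i)%nat with (S (e - i))%nat by (unfold d; lia).
  transitivity ((x * X) * (y * Y) * (A (S i) * X ^ S i * Y ^ S (e - i)))%C.
  + rewrite !(Cpow_S X), !(Cpow_S Y). cring. + rewrite HX, HY; cring. }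
assert (E0 : laplace_form (lap_coef p (INR d) a) e x y =
  (/ 2 * (sigma11 p * sum_n (fun i => A (S (S i)) * X ^ S i * Y ^ S (e - i)) e
   + 2 * sigma12 p * sum_n (fun i => A (S i) * X ^ S i * Y ^ S (e - i)) e
   + sigma22 p * sum_n (fun i => A i * X ^ S i * Y ^ S (e - i)) e))%C).
{ rewrite <- !Csum_mult_l, <- !Csum_plus, <- Csum_mult_l.
  apply Csum_ext; intros i Hi. unfold d. rewrite scaled_lap_coef by exact Hi.
  fold d A X Y. rewrite !RtoC_mult, !RtoC_plus, !RtoC_mult, RtoC_inv by lra. cring. }
transitivity (/ 2 * (sigma11 p * (x ^ 2 * laplace_form a d x y)
  + 2 * sigma12 p * (x * y * laplace_form a d x y)
  + sigma22 p * (y ^ 2 * laplace_form a d x y)))%C.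
{ unfold gamma. cring. }
rewrite E0, E1, E2, E3, !RtoC_mult, RtoC_inv by lra. cring.
Qed.

Lemma laplace_form_conj (a : nat -> R) (d : nat) (x y : C) : x <> 0 -> y <> 0 ->
  laplace_form a d (Cconj x) (Cconj y) = Cconj (laplace_form a d x y).
Proof.
intros Hx Hy. unfold laplace_form. rewrite Csum_conj. apply Csum_ext; intros i _.
rewrite !Cmult_conj, !Cpow_conj, !Cinv_conj by assumption.
do 2 f_equal. unfold Cconj, RtoC; simpl; f_equal; ring.
Qed.

Lemma laplace_form_homogeneous (a : nat -> R) (d : nat) (l x y : C) :
  l <> 0 -> x <> 0 -> y <> 0 ->
  laplace_form a d (l * x) (l * y) = ((/ l) ^ S (S d) * laplace_form a d x y)%C.
Proof.
intros Hl Hx Hy. unfold laplace_form. rewrite <- Csum_mult_l.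
apply Csum_ext; intros i Hi.
replace (S (S d)) with (S i + S (d - i))%nat by lia.
replace (/ (l * x))%C with (/ l * / x)%C by (field; split; assumption).
replace (/ (l * y))%C with (/ l * / y)%C by (field; split; assumption).
rewrite !Cpow_mult_l, Cpow_add_r. cring.
Qed.

Lemma laplace_form_linear (a b : nat -> R) (t : R) (d : nat) (x y : C) :
  laplace_form (fun i => t * a i + b i) d x y =
  (t * laplace_form a d x y + laplace_form b d x y)%C.
Proof.
unfold laplace_form. rewrite <- Csum_mult_l, <- Csum_plus.
apply Csum_ext; intros i _. unfold scaled.
rewrite Rmult_plus_distr_r, Rmult_assoc, RtoC_plus, (RtoC_mult t). cring.
Qed.

Lemma laplace_form_ext (a b : nat -> R) (d : nat) (x y : C) :
  (forall i, a i = b i) -> laplace_form a d x y = laplace_form b d x y.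
Proof.
intros H. apply Csum_ext; intros i _. unfold scaled. rewrite H. reflexivity.
Qed.

Lemma Csum_0 (f : nat -> C) (n : nat) :
  (forall i, (i <= n)%nat -> f i = 0) -> sum_n f n = RtoC 0.
Proof.
induction n as [|n IH]; intros H; [rewrite sum_O; apply H; lia|].
rewrite Csum_Sn, IH, H by (intros; try apply H; lia). cring.
Qed.

Lemma Csum_single (f : nat -> C) (n k : nat) : (k <= n)%nat ->
  (forall i, (i <= n)%nat -> i <> k -> f i = 0) -> sum_n f n = f k.
Proof.
revert k; induction n as [|n IH]; intros k Hk H.
- rewrite sum_O. f_equal; lia.
- rewrite Csum_Sn. destruct (Nat.eq_dec k (S n)) as [->|N].
  + rewrite Csum_0 by (intros; apply H; lia). cring.
  + rewrite (IH k), (H (S n)) by (try lia; intros; apply H; lia). cring.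
Qed.

(** The denominator [x^(d+1) y^(d+1)] turns the term of index [i] into a multiple of [x^(d-i) y^i],
    so the coefficients of [q] are the scaled ones in reverse order. *)
Lemma laplace_form_rational (a : nat -> R) (d : nat) :
  exists q : C -> C -> C, is_homogeneous_polynomial q /\
    forall x y : C, x <> 0 -> y <> 0 ->
      laplace_form a d x y = (q x y / (x ^ S d * y ^ S d))%C.
Proof.
exists (fun x y => sum_n (fun i => scaled a d (d - i) * x ^ i * y ^ (d - i))%C d).
split; [split|].
- exists d, (fun i j => if Nat.eqb (i + j) d then scaled a d j else 0). intros x y.
  apply Csum_ext; intros i Hi. symmetry.
  rewrite (Csum_single _ d (d - i)) by (try lia; intros j Hj Hn;
    replace (Nat.eqb (i + j) d) with false
      by (symmetry; apply Nat.eqb_neq; lia); cring).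
  replace (Nat.eqb (i + (d - i)) d) with true by (symmetry; apply Nat.eqb_eq; lia).
  reflexivity.
- exists d. intros l x y. rewrite <- Csum_mult_l. apply Csum_ext; intros i Hi.
  replace (l ^ d)%C with (l ^ i * l ^ (d - i))%C
    by (rewrite <- Cpow_add_r; f_equal; lia).
  rewrite !Cpow_mult_l. cring.
- intros x y Hx Hy. unfold Cdiv. rewrite Cmult_comm, <- Csum_mult_l.
  unfold laplace_form.
  assert (Rev : forall f : nat -> C, sum_n f d = sum_n (fun i => f (d - i)%nat) d).
  { clear. intros f. revert f. induction d as [|d IH]; intros f;
      [rewrite !sum_O; reflexivity|].
    rewrite Csum_Sn, Csum_shift, IH, Nat.sub_0_r.
    rewrite (Csum_ext _ (fun i => f (S d - S i)%nat)) by reflexivity. cring. }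
  rewrite Rev. apply Csum_ext; intros i Hi.
  replace (d - (d - i))%nat with i by lia.
  replace (x ^ S d)%C with (x ^ i * x ^ S (d - i))%C
    by (rewrite <- Cpow_add_r; f_equal; lia).
  replace (y ^ S d)%C with (y ^ S i * y ^ (d - i))%C
    by (rewrite <- Cpow_add_r; f_equal; lia).
  rewrite !Cpow_inv by assumption.
  assert (N : forall (z : C) n, z <> 0 -> (z ^ n)%C <> 0) by (intros; apply Cpow_nz; assumption).
  field; repeat split; first [assumption | apply N; assumption].
Qed.

(** * Solving one step of the recursion *)

Lemma gamma_c_plus (p : Z -> Z -> R) (y : C) :
  zero_drift_model p -> gamma p (c_plus p * y) y = 0.
Proof. intros H. rewrite gamma_factor by exact H. ring. Qed.

Lemma gamma_c_minus (p : Z -> Z -> R) (y : C) :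
  zero_drift_model p -> gamma p (c_minus p * y) y = 0.
Proof. intros H. rewrite gamma_factor by exact H. ring. Qed.

(** The two numbers are conjugate, so their powers agree exactly when [sin (D theta) = 0]; since
    [PI = N theta], this says that [N] divides [D]. *)
Lemma c_plus_pow_real (p : Z -> Z -> R) (N D : nat) : zero_drift_model p ->
  INR N * theta p = PI -> ((c_plus p ^ D)%C = (c_minus p ^ D)%C <-> exists k, D = (N * k)%nat).
Proof.
intros H HN.
assert (Hr := root_ratio_pos p H). destruct (theta_spec p H) as [[T1 T2] _].
assert (E : (c_plus p ^ D)%C = (c_minus p ^ D)%C <-> sin (INR D * theta p) = 0).
{ rewrite c_minus_eq, <- Cpow_conj, c_plus_eq, Cpow_mult_l, unit_root_pow, <- RtoC_pow.
  assert (Hp : 0 < root_ratio p ^ D) by (apply pow_lt; assumption).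
  unfold Cconj, Cmult, RtoC; simpl. split.
  - intros E. apply (f_equal Im) in E. simpl in E. nra.
  - intros ->. f_equal; ring. }
rewrite E. split.
- intros S0. destruct (sin_eq_0_0 _ S0) as [k Hk]. rewrite <- HN in Hk.
  assert (Hk' : IZR (Z.of_nat D) = IZR (k * Z.of_nat N)).
  { rewrite mult_IZR, <- !INR_IZR_INZ. apply Rmult_eq_reg_r with (theta p); lra. }
  apply eq_IZR in Hk'.
  assert (0 < N)%nat by (apply INR_lt; simpl; nra).
  exists (Z.to_nat k). nia.
- intros [k ->]. apply sin_multiple, HN.
Qed.

Lemma laplace_form_0 (d : nat) (x y : C) : laplace_form (fun _ => 0) d x y = 0.
Proof. apply Csum_0; intros i _. unfold scaled. rewrite Rmult_0_l. cring. Qed.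

(** For a harmonic polynomial only the two boundary terms remain. Evaluation at [x = c_plus y],
    where the kernel vanishes, expresses the term in [y] through [P], so [Q] need not be
    computed. *)
Lemma gamma_laplace_wedge (p : Z -> Z -> R) (N k : nat) : zero_drift_model p ->
  (2 <= N)%nat -> INR N * theta p = PI -> (1 <= k)%nat ->
  exists P : R, P <> 0 /\ forall x y : C, x <> 0 -> y <> 0 ->
    (gamma p x y * laplace_form (wedge_coef p (N * k) 0) (N * k) x y =
     P * ((/ x) ^ (N * k) - (/ (c_plus p * y)) ^ (N * k)))%C.
Proof.
intros H N2 HN Hk.
destruct (wedge_coef_boundary p (N * k) 0 H (sin_multiple p N k HN)) as [B0 B1].
destruct (lap_wedge_coef p H) as [K [_ EK]].
rewrite Nat.mul_0_r, Nat.add_0_r in B1.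
assert (EK' := EK (N * k)%nat 0%nat). rewrite Nat.mul_0_r, Nat.add_0_r in EK'.
assert (Hsub := wedge_coef_subtop p (pred (N * k)) H).
destruct (N * k)%nat as [|[|e]] eqn:Ed; [nia|nia|]. simpl pred in Hsub.
set (a := wedge_coef p (S (S e)) 0) in *.
set (P := / 2 * sigma22 p * scaled a (S (S e)) (S e)).
set (Q := / 2 * sigma11 p * scaled a (S (S e)) 1).
exists P. split.
- pose proof (sigma22_pos p H). unfold P, scaled.
  repeat apply Rmult_integral_contrapositive_currified; try lra; auto;
  apply INR_fact_neq_0.
- assert (E : forall x y : C, x <> 0 -> y <> 0 ->
    (gamma p x y * laplace_form a (S (S e)) x y =
     P * (/ x) ^ S (S e) + Q * (/ y) ^ S (S e))%C).
  { intros x y Hx Hy. rewrite gamma_laplace_form by assumption. fold P Q.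
    rewrite (laplace_form_ext _ (fun _ => 0)), laplace_form_0; [ring|].
    intros i; rewrite EK'; simpl; ring. }
  intros x y Hx Hy. rewrite E by assumption.
  assert (E' := E (c_plus p * y)%C y (Cmult_neq_0 _ _ (c_plus_neq0 p H) Hy) Hy).
  rewrite gamma_c_plus, Cmult_0_l in E' by exact H.
  transitivity (P * (/ x) ^ S (S e) - P * (/ (c_plus p * y)) ^ S (S e)
    + (P * (/ (c_plus p * y)) ^ S (S e) + Q * (/ y) ^ S (S e)))%C; [ring|].
  rewrite <- E'. ring.
Qed.

Lemma Cinv_pow_inj (a b : C) (n : nat) : a <> 0 -> b <> 0 ->
  ((/ a) ^ n = (/ b) ^ n)%C -> (a ^ n = b ^ n)%C.
Proof.
intros Ha Hb E. rewrite !Cpow_inv in E by assumption.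
assert (H := Cpow_nz a n Ha). assert (H' := Cpow_nz b n Hb).
assert (I : forall z : C, z <> 0 -> (/ / z)%C = z)
  by (intros z Hz; field; exact Hz).
rewrite <- (I (a ^ n)%C H), E. exact (I _ H').
Qed.

(* [beta] is the coefficient of the monomial decoupling function of the
   transform of [a], and [a'] the next polynomial of the family. *)
Definition laplace_step (p : Z -> Z -> R) (d : nat) (a a' : nat -> R) (beta : C)
    : Prop :=
  (forall i, lap_coef p (INR (S (S d))) a' i = a i) /\
  ((c_plus p ^ S (S d))%C = (c_minus p ^ S (S d))%C -> beta = 0) /\
  (forall y : C, y <> 0 ->
     beta * (/ (c_plus p * y)) ^ S (S d) - beta * (/ (c_minus p * y)) ^ S (S d) =
     laplace_form a d (c_plus p * y) y - laplace_form a d (c_minus p * y) y)%C /\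
  (forall x y : C, x <> 0 -> y <> 0 ->
     gamma p x y * laplace_form a' (S (S d)) x y =
     laplace_form a d x y - beta * (/ x) ^ S (S d)
     - (laplace_form a d (c_plus p * y) y - beta * (/ (c_plus p * y)) ^ S (S d)))%C.

Lemma laplace_step_exists (p : Z -> Z -> R) (N d : nat) (a : nat -> R) :
  zero_drift_model p -> (2 <= N)%nat -> INR N * theta p = PI ->
  wedge_span p N d a ->
  exists a' beta, wedge_span p N (S (S d)) a' /\ laplace_step p d a a' beta.
Proof.
intros H N2 HN Ha.
assert (N1 : (1 <= N)%nat) by lia.
destruct (wedge_span_solve p N d a H N1 Ha) as [b [Hb Lb]].
destruct (wedge_span_boundary p N _ b H HN Hb) as [B0 B1].
set (D := S (S d)) in *.
set (P := / 2 * sigma22 p * scaled b D (S d)).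
set (Q := / 2 * sigma11 p * scaled b D 1).
assert (E : forall x y : C, x <> 0 -> y <> 0 ->
  (gamma p x y * laplace_form b D x y =
   laplace_form a d x y + P * (/ x) ^ D + Q * (/ y) ^ D)%C).
{ intros x y Hx Hy. unfold D. rewrite gamma_laplace_form by assumption.
  fold D P Q. rewrite (laplace_form_ext _ a) by exact Lb. reflexivity. }
(* On either kernel line the left side of [E] vanishes. The term in [Q] is the same on both lines
   and drops out of the decoupling equation. *)
assert (Ep : forall y : C, y <> 0 ->
  (laplace_form a d (c_plus p * y) y =
   - (P * (/ (c_plus p * y)) ^ D) - Q * (/ y) ^ D)%C).
{ intros y Hy.
  assert (E' := E (c_plus p * y)%C y (Cmult_neq_0 _ _ (c_plus_neq0 p H) Hy) Hy).
  rewrite gamma_c_plus, Cmult_0_l in E' by exact H.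
  transitivity (0 - P * (/ (c_plus p * y)) ^ D - Q * (/ y) ^ D)%C; [|ring].
  rewrite E'. ring. }
assert (Em : forall y : C, y <> 0 ->
  (laplace_form a d (c_minus p * y) y =
   - (P * (/ (c_minus p * y)) ^ D) - Q * (/ y) ^ D)%C).
{ intros y Hy.
  assert (E' := E (c_minus p * y)%C y (Cmult_neq_0 _ _ (c_minus_neq0 p H) Hy) Hy).
  rewrite gamma_c_minus, Cmult_0_l in E' by exact H.
  transitivity (0 - P * (/ (c_minus p * y)) ^ D - Q * (/ y) ^ D)%C; [|ring].
  rewrite E'. ring. }
assert (Dec : {(c_plus p ^ D)%C = (c_minus p ^ D)%C} + {(c_plus p ^ D)%C <> (c_minus p ^ D)%C})
  by apply Ceq_dec.
destruct Dec as [Deg|Deg].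
- destruct (proj1 (c_plus_pow_real p N D H HN) Deg) as [k Hk].
  assert (Hk1 : (1 <= k)%nat) by (destruct k; [unfold D in Hk; lia|lia]).
  destruct (gamma_laplace_wedge p N k H N2 HN Hk1) as [P' [HP' E']].
  rewrite <- Hk in E'.
  (* Chosen so that the boundary term [t P'] of the added harmonic polynomial cancels [P]; the
     Laplacian is unchanged. *)
  set (t := - P / P').
  exists (fun i => t * wedge_coef p (N * k) 0 i + b i), 0.
  split; [constructor; auto; lia|]. split; [|split; [|split]].
  + intros i. fold D.
    destruct (lap_wedge_coef p H) as [K [_ EK]].
    assert (EK' := EK (N * k)%nat 0%nat i).
    rewrite Nat.mul_0_r, Nat.add_0_r, <- Hk in EK'. change (INR 0) with 0 in EK'.
    rewrite <- Lb. transitivity (t * lap_coef p (INR D) (wedge_coef p D 0) i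
      + lap_coef p (INR D) b i); [|rewrite EK'; ring].
    rewrite Hk. unfold lap_coef. ring.
  + reflexivity.
  + intros y Hy. fold D. rewrite Ep, Em by exact Hy.
    assert (C1 := c_plus_neq0 p H). assert (C2 := c_minus_neq0 p H).
    rewrite !Cpow_inv by (apply Cmult_neq_0; assumption).
    rewrite !Cpow_mult_l, Deg. ring.
  + intros x y Hx Hy. fold D. rewrite laplace_form_linear, <- Hk.
    transitivity (t * (gamma p x y * laplace_form (wedge_coef p D 0) D x y)
      + gamma p x y * laplace_form b D x y)%C; [ring|].
    rewrite E', E, Ep by assumption.
    assert (Ht : (t * P')%C = (- P)%C).
    { rewrite <- RtoC_mult, <- RtoC_opp. f_equal. unfold t; field; exact HP'. }
    rewrite (Cmult_assoc t P'), Ht. ring.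
- exists b, (- P)%C. split; [exact Hb|]. split; [exact Lb|split; [|split]].
  + intros; contradiction.
  + intros y Hy. fold D. rewrite Ep, Em by exact Hy. ring.
  + intros x y Hx Hy. fold D. rewrite E, Ep by assumption. ring.
Qed.

(** * Uniqueness of the family *)

Section ComplexContinuity.
Context {U : UniformSpace}.

Lemma continuous_pair_R (f g : U -> R) (x : U) :
  continuous f x -> continuous g x ->
  continuous (U := C_UniformSpace) (fun t => (f t, g t) : C) x.
Proof.
intros Hf Hg. apply (continuous_comp_2 f g (fun v w => (v, w)) x Hf Hg).
apply continuous_ext with (fun z : R * R => z); [intros []; reflexivity|].
apply continuous_id.
Qed.

Lemma continuous_Re (f : U -> C) (x : U) :
  continuous (U := C_UniformSpace) f x -> continuous (fun t => Re (f t)) x.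
Proof.
intros Hf. apply (continuous_comp f (fun z : R * R => fst z)); [exact Hf|].
destruct (f x). apply continuous_fst.
Qed.

Lemma continuous_Im (f : U -> C) (x : U) :
  continuous (U := C_UniformSpace) f x -> continuous (fun t => Im (f t)) x.
Proof.
intros Hf. apply (continuous_comp f (fun z : R * R => snd z)); [exact Hf|].
destruct (f x). apply continuous_snd.
Qed.

Lemma continuous_Cplus (f g : U -> C) (x : U) :
  continuous (U := C_UniformSpace) f x -> continuous (U := C_UniformSpace) g x ->
  continuous (U := C_UniformSpace) (fun t => f t + g t)%C x.
Proof.
intros Hf Hg. apply continuous_pair_R.
- apply (continuous_plus (V := R_NormedModule)); apply continuous_Re; assumption.
- apply (continuous_plus (V := R_NormedModule)); apply continuous_Im; assumption.
Qed.

Lemma continuous_Cmult (f g : U -> C) (x : U) :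
  continuous (U := C_UniformSpace) f x -> continuous (U := C_UniformSpace) g x ->
  continuous (U := C_UniformSpace) (fun t => f t * g t)%C x.
Proof.
intros Hf Hg.
assert (Rf := continuous_Re f x Hf). assert (If := continuous_Im f x Hf).
assert (Rg := continuous_Re g x Hg). assert (Ig := continuous_Im g x Hg).
apply continuous_pair_R.
- exact (continuous_minus (V := R_NormedModule) _ _ x
    (continuous_mult (K := R_AbsRing) _ _ x Rf Rg)
    (continuous_mult (K := R_AbsRing) _ _ x If Ig)).
- exact (continuous_plus (V := R_NormedModule) _ _ x
    (continuous_mult (K := R_AbsRing) _ _ x Rf Ig)
    (continuous_mult (K := R_AbsRing) _ _ x If Rg)).
Qed.

Lemma continuous_Cinv (f : U -> C) (x : U) :
  continuous (U := C_UniformSpace) f x -> f x <> 0 ->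
  continuous (U := C_UniformSpace) (fun t => / f t)%C x.
Proof.
intros Hf H0.
assert (Rf := continuous_Re f x Hf). assert (If := continuous_Im f x Hf).
assert (HD : continuous (fun t => / (fst (f t) ^ 2 + snd (f t) ^ 2)) x).
{ apply (continuous_comp (fun t => fst (f t) ^ 2 + snd (f t) ^ 2) Rinv).
  - apply continuous_ext with
      (fun t => Re (f t) * Re (f t) + Im (f t) * Im (f t));
      [intros t; unfold Re, Im;
       match goal with |- @eq _ ?a ?b => change (@eq R a b) end; ring|].
    exact (continuous_plus (V := R_NormedModule) _ _ x
      (continuous_mult (K := R_AbsRing) _ _ x Rf Rf)
      (continuous_mult (K := R_AbsRing) _ _ x If If)).
  - apply continuous_Rinv.
    intros E. apply H0. destruct (f x) as [s t]; simpl in E.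
    assert (s = 0) by nra. assert (t = 0) by nra. subst; reflexivity. }
apply continuous_pair_R; apply (continuous_mult (K := R_AbsRing)); try exact HD.
- apply continuous_Re, Hf.
- apply (continuous_opp (V := R_NormedModule)), continuous_Im, Hf.
Qed.

Lemma continuous_Cpow (f : U -> C) (n : nat) (x : U) :
  continuous (U := C_UniformSpace) f x ->
  continuous (U := C_UniformSpace) (fun t => f t ^ n)%C x.
Proof.
intros Hf. induction n as [|n IH]; [apply continuous_const|].
apply (continuous_Cmult f (fun t => f t ^ n)%C); assumption.
Qed.

Lemma continuous_Csum (f : nat -> U -> C) (n : nat) (x : U) :
  (forall i, continuous (U := C_UniformSpace) (f i) x) ->
  continuous (U := C_UniformSpace) (fun t => sum_n (fun i => f i t) n : C) x.
Proof.
intros Hf. induction n as [|n IH].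
- apply continuous_ext with (f 0%nat); [intros; rewrite sum_O; reflexivity|apply Hf].
- apply continuous_ext with (fun t => (sum_n (fun i => f i t) n : C) + f (S n) t)%C;
    [intros; rewrite Csum_Sn; reflexivity|].
  apply continuous_Cplus; [exact IH | apply Hf].
Qed.

End ComplexContinuity.

Lemma continuous_laplace_form (a : nat -> R) (d : nat) (x y : C) :
  x <> 0 -> y <> 0 ->
  continuous (fun z : C * C => laplace_form a d (fst z) (snd z)) (x, y).
Proof.
intros Hx Hy. unfold laplace_form.
apply (continuous_Csum (U := prod_UniformSpace C_UniformSpace C_UniformSpace)).
intros i. apply continuous_Cmult; [apply continuous_Cmult|].
- apply continuous_const.
- apply (continuous_Cpow (fun z : C * C => (/ fst z)%C)), continuous_Cinv;
    [apply continuous_fst | exact Hx].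
- apply (continuous_Cpow (fun z : C * C => (/ snd z)%C)), continuous_Cinv;
    [apply continuous_snd | exact Hy].
Qed.

Lemma Cmult_eq_0 (a b : C) : (a * b)%C = 0 -> a = 0 \/ b = 0.
Proof.
intros E. destruct (Ceq_dec a 0) as [|Ha]; [left; assumption|].
destruct (Ceq_dec b 0) as [|Hb]; [right; assumption|].
exfalso. exact (Cmult_neq_0 a b Ha Hb E).
Qed.

(** The kernel vanishes only on the two lines. Scaling [x] by [1 + t] leaves the current line
    because [t] is non-zero, and cannot reach the other one because a positive factor keeps the sign
    of an imaginary part, while [c_plus] and [c_minus] have imaginary parts of opposite signs. *)
Lemma gamma_perturb (p : Z -> Z -> R) (x y : C) (t : R) : zero_drift_model p ->
  y <> 0 -> gamma p x y = 0 -> t <> 0 -> Rabs t < 1 ->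
  gamma p ((1 + t)%R * x) y <> 0.
Proof.
intros H Hy G Ht Ht1 G'.
assert (S1 := sigma11_pos p H). assert (Hr := root_ratio_pos p H).
assert (Hs := sin_theta_pos p H). apply Rabs_lt_between in Ht1.
rewrite gamma_factor in G, G' by exact H.
assert (I := Cmult_eq_0).
assert (K : (sigma11 p / 2)%C <> 0).
{ intros E. destruct (I _ _ E) as [F|F]; [apply RtoC_inj in F; lra|].
  rewrite <- RtoC_inv in F by lra. apply RtoC_inj in F. lra. }
assert (Sb : forall a b : C, (a - b)%C = 0 -> a = b)
  by (intros a b E; replace a with ((a - b) + b)%C by ring; rewrite E; ring).
assert (D : forall s : R, ((1 + t)%R * (root_ratio p * (cos (theta p), s)%R))%C
   = (root_ratio p * (cos (theta p), (- s)%R))%C -> s = 0).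
{ intros s E. apply (f_equal Im) in E. simpl in E.
  assert (E' : root_ratio p * ((2 + t) * s) = 0) by lra.
  apply Rmult_integral in E'. destruct E' as [E'|E']; [lra|].
  apply Rmult_integral in E'. destruct E'; lra. }
assert (T : forall z : C, ((1 + t)%R * z)%C = z -> z = 0).
{ intros z E. assert (E' : (t * z)%C = 0).
  { transitivity ((1 + t)%R * z - z)%C; [rewrite RtoC_plus; ring|]. rewrite E; ring. }
  destruct (I _ _ E') as [F|F]; [apply RtoC_inj in F; lra|exact F]. }
assert (Cc : forall a b : C, (a * y = b * y)%C -> a = b).
{ intros a b E. apply Sb. destruct (I (a - b)%C y); [|assumption|contradiction].
  transitivity (a * y - b * y)%C; [ring|rewrite E; ring]. }
assert (Em : c_minus p = (root_ratio p * (cos (theta p), (- sin (theta p))%R))%C).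
{ rewrite c_minus_eq, c_plus_eq, Cmult_conj. unfold unit_root, Cconj, RtoC, Cmult; simpl.
  f_equal; ring. }
assert (Ep := c_plus_eq p). unfold unit_root in Ep.
destruct (I _ _ G) as [G1|G1]; [destruct (I _ _ G1) as [|G2]; [contradiction|]|];
[apply Sb in G2; subst x | apply Sb in G1; subst x];
(destruct (I _ _ G') as [F1|F1]; [destruct (I _ _ F1) as [|F2]; [contradiction|]|];
[apply Sb in F2; rename F2 into F | apply Sb in F1; rename F1 into F]).
- apply T in F. exact (Cmult_neq_0 _ _ (c_plus_neq0 p H) Hy F).
- rewrite Cmult_assoc in F. apply Cc in F. rewrite Ep, Em in F.
  apply D in F. lra.
- rewrite Cmult_assoc in F. apply Cc in F. rewrite Ep, Em in F.
  enough (- sin (theta p) = 0) by lra. apply D. rewrite F.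
  rewrite Ropp_involutive. reflexivity.
- apply T in F. exact (Cmult_neq_0 _ _ (c_minus_neq0 p H) Hy F).
Qed.

(** Off the kernel lines both functions are [G / gamma]. A point on a line is the limit, as [t]
    tends to 0 from the right, of the points [((1 + t) x, y)] off the lines, so continuity forces
    equality there too. *)
Lemma kernel_quotient_eq (p : Z -> Z -> R) (G F L : C -> C -> C) :
  zero_drift_model p -> is_kernel_quotient p G F ->
  (forall x y : C, x <> 0 -> y <> 0 ->
     continuous (fun z : C * C => L (fst z) (snd z)) (x, y)) ->
  (forall x y : C, x <> 0 -> y <> 0 -> (gamma p x y * L x y = G x y)%C) ->
  forall x y : C, x <> 0 -> y <> 0 -> F x y = L x y.
Proof.
intros H [Fc Fq] Lc Lq x y Hx Hy.
assert (Off : forall x y : C, x <> 0 -> y <> 0 -> gamma p x y <> 0 -> F x y = L x y).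
{ intros x' y' Hx' Hy' Hg. rewrite Fq, <- Lq by assumption. field. exact Hg. }
destruct (Ceq_dec (gamma p x y) 0) as [G0|G0]; [|apply Off; assumption].
set (path := fun t : R => ((1 + t)%R * x, y)%C).
assert (Pc : continuous (U := prod_UniformSpace C_UniformSpace C_UniformSpace) path 0).
{ apply (continuous_comp_2 (fun t : R => ((1 + t)%R * x)%C) (fun _ => y)
    (fun v w => (v, w))).
  - apply continuous_Cmult; [|apply continuous_const].
    apply continuous_pair_R; [|apply continuous_const].
    apply (continuous_plus (V := R_NormedModule));
      [apply continuous_const | apply continuous_id].
  - apply continuous_const.
  - apply continuous_ext with (fun z : C * C => z); [intros []; reflexivity|].
    apply continuous_id. }
assert (P0 : path 0 = (x, y)) by (unfold path; f_equal; rewrite Rplus_0_r; ring).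
assert (Lim : forall M : C -> C -> C,
  continuous (fun z : C * C => M (fst z) (snd z)) (x, y) ->
  filterlim (fun t => M (fst (path t)) (snd (path t))) (at_right 0)
    (locally (T := C_UniformSpace) (M x y))).
{ intros M Mc. rewrite <- P0 in Mc.
  assert (Q := continuous_comp path _ 0 Pc Mc).
  unfold continuous in Q. rewrite P0 in Q. simpl in Q.
  refine (filterlim_filter_le_1 _ _ Q).
  intros P HP. unfold at_right, within. apply filter_imp with (2 := HP). auto. }
apply (filterlim_locally_unique (V := C_R_NormedModule) (F := at_right 0)
  (fun t => L (fst (path t)) (snd (path t)))); [|apply Lim, Lc; assumption].
apply filterlim_ext_loc with (2 := Lim F (Fc x y Hx Hy)).
exists (mkposreal 1 Rlt_0_1). intros t Ht Ht0. apply Rgt_not_eq in Ht0.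
assert (Ht1 : Rabs t < 1).
{ unfold ball in Ht; simpl in Ht. unfold AbsRing_ball, abs, minus, plus, opp in Ht; simpl in Ht.
  rewrite Ropp_0, Rplus_0_r in Ht. exact Ht. }
apply Off; simpl.
- apply Cmult_neq_0; [|exact Hx]. intros E. apply RtoC_inj in E.
  apply Rabs_lt_between in Ht1. lra.
- exact Hy.
- apply gamma_perturb; assumption.
Qed.

Lemma CpowZ_neg (z : C) (D : nat) : z <> 0 ->
  CpowZ z (- Z.of_nat D) = ((/ z) ^ D)%C.
Proof.
intros Hz. rewrite Cpow_inv by exact Hz. destruct D as [|D]; simpl.
- field.
- rewrite SuccNat2Pos.id_succ. reflexivity.
Qed.

(** Integer powers of 2 are distinct, so homogeneity tested at the single value [lambda = 2]
    determines the degree. *)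
Lemma CpowZ_2 (D : nat) (m : Z) : CpowZ 2 m = ((/ 2) ^ S D)%C -> m = (- Z.of_nat (S D))%Z.
Proof.
assert (P : forall n, 1 <= 2 ^ n) by (intros; apply pow_R1_Rle; lra).
assert (L : (/ 2) ^ S D < 1).
{ rewrite pow_inv. rewrite <- Rinv_1. apply Rinv_lt_contravar.
  - rewrite Rmult_1_l. apply pow_lt; lra.
  - simpl. pose proof (P D). lra. }
rewrite <- RtoC_inv, <- RtoC_pow by lra.
destruct m as [|n|n]; simpl CpowZ; intros E.
- apply RtoC_inj in E. lra.
- rewrite <- RtoC_pow in E. apply RtoC_inj in E. pose proof (P (Pos.to_nat n)). lra.
- rewrite <- RtoC_pow, <- RtoC_inv in E
    by (apply Rgt_not_eq, Rlt_gt, pow_lt; lra).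
  apply RtoC_inj in E. rewrite pow_inv in E. apply Rinv_eq_reg in E.
  assert (E' : Pos.to_nat n = S D); [|rewrite <- E'; lia].
  destruct (Nat.lt_trichotomy (Pos.to_nat n) (S D)) as [T|[T|T]]; [|exact T|];
    apply (Rlt_pow 2) in T; lra.
Qed.

Ltac Cneq0 := repeat first [assumption | apply Cmult_neq_0].

Lemma step_decoupling (p : Z -> Z -> R) (d : nat) (a a' : nat -> R) (beta : C)
    (f : C -> C) (G : C -> C -> C) :
  zero_drift_model p -> laplace_step p d a a' beta ->
  (forall x y : C, x <> 0 -> y <> 0 -> G x y = laplace_form a d x y) ->
  (forall x : C, x <> 0 -> f x = (beta * (/ x) ^ S (S d))%C) ->
  is_monomial_decoupling p G f.
Proof.
intros H [_ [B [Dc _]]] HG Hf.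
assert (C1 := c_plus_neq0 p H). assert (C2 := c_minus_neq0 p H).
exists (- Z.of_nat (S (S d)))%Z, beta. split; [|split; [|split]].
- intros l y Hl Hy. rewrite CpowZ_neg by exact Hl.
  rewrite !HG by (Cneq0).
  rewrite <- laplace_form_homogeneous by (Cneq0).
  f_equal. ring.
- rewrite !CpowZ_neg by assumption. intros E. apply B, Cinv_pow_inj; assumption.
- intros x Hx. rewrite CpowZ_neg by exact Hx. apply Hf, Hx.
- intros y Hy. rewrite !HG, !Hf by (Cneq0).
  apply Dc, Hy.
Qed.

(** Both monomials solve the same decoupling equation at [y = 1]. Once the exponents agree, that
    equation fixes the coefficient unless the powers of [c_plus] and [c_minus] coincide, and then
    both coefficients are 0 by convention. *)
Lemma decoupling_unique (p : Z -> Z -> R) (d : nat) (a a' : nat -> R) (beta : C)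
    (f : C -> C) (G : C -> C -> C) :
  zero_drift_model p -> laplace_step p d a a' beta ->
  (forall x y : C, x <> 0 -> y <> 0 -> G x y = laplace_form a d x y) ->
  is_monomial_decoupling p G f ->
  forall x : C, x <> 0 -> f x = (beta * (/ x) ^ S (S d))%C.
Proof.
intros H [_ [B [Dc _]]] HG [m [beta' [Hom [B' [Hf Dc']]]]].
assert (C1 := c_plus_neq0 p H). assert (C2 := c_minus_neq0 p H).
set (D := S (S d)) in *.
assert (N1 : RtoC 1 <> 0) by (intros E; apply RtoC_inj in E; lra).
assert (N2 : RtoC 2 <> 0) by (intros E; apply RtoC_inj in E; lra).
assert (Dc1 := Dc 1 N1). assert (Dc1' := Dc' 1 N1).
rewrite !Hf, !HG in Dc1' by (Cneq0).
rewrite !Cmult_1_r in Dc1, Dc1'.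
set (Lp := laplace_form a d (c_plus p) 1) in *.
set (Lm := laplace_form a d (c_minus p) 1) in *.
assert (Sb : forall u v : C, (u - v)%C = 0 -> u = v)
  by (intros u v E; replace u with ((u - v) + v)%C by ring; rewrite E; ring).
(* If [Lp] vanishes, the exponent [m] is not determined. Since the coefficients are real, [Lm] is
   the conjugate of [Lp] and vanishes too, so both coefficients are 0 whatever [m] is. *)
destruct (Ceq_dec Lp 0) as [L0|L0].
- assert (L0' : Lm = 0).
  { unfold Lm. rewrite c_minus_eq.
    replace (RtoC 1) with (Cconj 1) by (unfold Cconj, RtoC; simpl; f_equal; ring).
    rewrite laplace_form_conj by assumption. fold Lp. rewrite L0.
    unfold Cconj, RtoC; simpl; f_equal; ring. }
  rewrite L0, L0' in *.
  assert (Z : beta = 0).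
  { destruct (Cmult_eq_0 beta ((/ c_plus p) ^ D - (/ c_minus p) ^ D)%C) as [E|E];
      [|exact E|].
    - transitivity (beta * (/ c_plus p) ^ D - beta * (/ c_minus p) ^ D)%C; [ring|].
      rewrite Dc1; ring.
    - apply B, Cinv_pow_inj; auto. }
  assert (Z' : beta' = 0).
  { destruct (Cmult_eq_0 beta' (CpowZ (c_plus p) m - CpowZ (c_minus p) m)%C) as [E|E];
      [|exact E|].
    - transitivity (beta' * CpowZ (c_plus p) m - beta' * CpowZ (c_minus p) m)%C;
        [ring|]. rewrite Dc1'; ring.
    - apply B', Sb, E. }
  intros x Hx. rewrite Hf, Z, Z' by exact Hx. ring.
- assert (Em : m = (- Z.of_nat D)%Z).
  { apply CpowZ_2. fold D. apply Sb.
    destruct (Cmult_eq_0 (CpowZ 2 m - (/ 2) ^ D)%C Lp) as [E|E];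
      [|exact E|contradiction].
    assert (E := Hom 2 1 N2 N1).
    rewrite !HG in E by (Cneq0).
    replace (c_plus p * (2 * 1))%C with (2 * c_plus p)%C in E by ring.
    rewrite laplace_form_homogeneous in E by assumption.
    rewrite Cmult_1_r in E. fold D Lp in E.
    transitivity (CpowZ 2 m * Lp - (/ 2) ^ D * Lp)%C; [ring|].
    rewrite E. ring. }
  subst m. rewrite !CpowZ_neg in * by assumption.
  assert (Z : beta' = beta).
  { destruct (Ceq_dec ((/ c_plus p) ^ D)%C ((/ c_minus p) ^ D)%C) as [E|E].
    - rewrite B' by exact E. symmetry. apply B, Cinv_pow_inj; auto.
    - apply Sb.
      destruct (Cmult_eq_0 (beta' - beta)%C ((/ c_plus p) ^ D - (/ c_minus p) ^ D)%C)
        as [F|F]; [|exact F|exfalso; apply E, Sb, F].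
      transitivity ((beta' * (/ c_plus p) ^ D - beta' * (/ c_minus p) ^ D)
        - (beta * (/ c_plus p) ^ D - beta * (/ c_minus p) ^ D))%C; [ring|].
      rewrite Dc1, Dc1'. ring. }
  intros x Hx. rewrite Hf, CpowZ_neg, Z by exact Hx. reflexivity.
Qed.

(** * The sequence of polynomials *)

Fixpoint degree (d n : nat) : nat :=
  match n with O => d | S m => S (S (degree d m)) end.

(** The degree of the [n]-th polynomial is [N k + 2 n]; [degree] is recursive so that successive
    degrees match [S (S d)] in [laplace_step] by computation. *)
Lemma wedge_sequence (p : Z -> Z -> R) (N k : nat) :
  zero_drift_model p -> (2 <= N)%nat -> INR N * theta p = PI -> (1 <= k)%nat ->
  exists (a : nat -> nat -> R) (beta : nat -> C),
    (forall n, wedge_span p N (degree (N * k) n) (a n)) /\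
    (forall i, lap_coef p (INR (N * k)) (a 0%nat) i = 0) /\
    (forall x y : C, x <> 0 -> y <> 0 ->
       gamma p x y * laplace_form (a 0%nat) (N * k) x y =
       (/ x) ^ (N * k) - (/ (c_plus p * y)) ^ (N * k))%C /\
    (forall n, laplace_step p (degree (N * k) n) (a n) (a (S n)) (beta n)).
Proof.
intros H N2 HN Hk.
destruct (gamma_laplace_wedge p N k H N2 HN Hk) as [P [HP EP]].
destruct (lap_wedge_coef p H) as [K [_ EK]].
(* Division by [P] normalises the boundary term in [x] to [x^-(N k)]; the added 0 gives the shape of
   [wedge_span_add]. *)
set (a0 := fun i => / P * wedge_coef p (N * k) 0 i + 0).
(* Choice needs a successor for every pair, so membership in the span is a premise inside the
   existential, with a dummy successor outside the span. *)
assert (Hc : forall s : nat * (nat -> R), exists t : (nat -> R) * C,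
  wedge_span p N (degree (N * k) (fst s)) (snd s) ->
  wedge_span p N (degree (N * k) (S (fst s))) (fst t) /\
  laplace_step p (degree (N * k) (fst s)) (snd s) (fst t) (snd t)).
{ intros [n a]. simpl fst; simpl snd.
  destruct (classic (wedge_span p N (degree (N * k) n) a)) as [Ha|Ha].
  - destruct (laplace_step_exists p N _ a H N2 HN Ha) as [a' [b Hb]].
    exists (a', b). intros _. exact Hb.
  - exists (a, RtoC 0). intros; contradiction. }
apply functional_choice in Hc. destruct Hc as [next Hnext].
set (a := fix a n := match n with O => a0 | S m => fst (next (m, a m)) end).
assert (Ha : forall n, wedge_span p N (degree (N * k) n) (a n)).
{ induction n as [|n IH].
  - apply wedge_span_add with (k := k) (j := 0%nat); [exact Hk|simpl; lia|constructor].
  - apply (Hnext (n, a n)), IH. }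
exists a, (fun n => snd (next (n, a n))). split; [exact Ha|split; [|split]].
- intros i. assert (E := EK (N * k)%nat 0%nat i).
  rewrite Nat.mul_0_r, Nat.add_0_r in E. change (INR 0) with 0 in E.
  transitivity (/ P * lap_coef p (INR (N * k)) (wedge_coef p (N * k) 0) i);
    [|rewrite E; ring].
  simpl; unfold a0, lap_coef. ring.
- intros x y Hx Hy. simpl; unfold a0.
  rewrite laplace_form_linear, laplace_form_0.
  transitivity (/ P * (gamma p x y * laplace_form (wedge_coef p (N * k) 0) (N * k) x y))%C;
    [rewrite RtoC_inv by exact HP; ring|].
  rewrite EP by assumption. field. intros E; apply HP, RtoC_inj, E.
- intros n. apply (Hnext (n, a n)), Ha.
Qed.

Lemma omega_hat_pow (N k : nat) (x : C) : x <> 0 ->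
  (omega_hat (Z.of_nat N) x ^ k)%C = ((/ x) ^ (N * k))%C.
Proof.
intros Hx. unfold omega_hat. rewrite CpowZ_neg, Cpow_mult_r by exact Hx. reflexivity.
Qed.

(** * Laplacian and Laplace transform of a form *)

Lemma Rsum_Sn (f : nat -> R) (n : nat) : sum_n f (S n) = sum_n f n + f (S n).
Proof. exact (sum_Sn f n). Qed.

Lemma Rsum_shift (f : nat -> R) (n : nat) :
  sum_n f (S n) = f 0%nat + sum_n (fun i => f (S i)) n.
Proof.
induction n as [|n IH].
- rewrite Rsum_Sn, !sum_O. reflexivity.
- rewrite Rsum_Sn, IH, Rsum_Sn. apply Rplus_assoc.
Qed.

Lemma is_derive_poly (a w : nat -> R) (n : nat) (u : R) :
  is_derive (fun u => sum_n (fun i => a i * u ^ i * w i) n) u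
    (sum_n (fun i => a i * (INR i * u ^ pred i) * w i) n).
Proof.
induction n as [|n IH].
- apply is_derive_ext with (fun _ => a 0%nat * 1 * w 0%nat);
    [intros; rewrite sum_O; reflexivity|].
  rewrite sum_O. auto_derive; [exact I|]. simpl; ring.
- apply is_derive_ext with (fun u => sum_n (fun i => a i * u ^ i * w i) n
    + a (S n) * u ^ S n * w (S n)); [intros; rewrite Rsum_Sn; reflexivity|].
  rewrite Rsum_Sn. apply (is_derive_plus (V := R_NormedModule)); [exact IH|].
  auto_derive; [exact I|]. simpl pred. simpl INR. ring.
Qed.

Definition du_coef (a : nat -> R) (i : nat) : R := (INR i + 1) * a (S i).
Definition dv_coef (d : R) (a : nat -> R) (i : nat) : R := (d - INR i) * a i.

Lemma is_derive_form_u (a : nat -> R) (d : nat) (u v : R) :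
  is_derive (fun u => form a (S d) u v) u (form (du_coef a) d u v).
Proof.
unfold form.
evar_last; [apply (is_derive_poly a (fun i => v ^ (S d - i)))|].
rewrite Rsum_shift. simpl INR at 1. rewrite Rmult_0_l, Rmult_0_r, Rmult_0_l, Rplus_0_l.
apply sum_n_ext; intros i. unfold du_coef. rewrite S_INR.
replace (S d - S i)%nat with (d - i)%nat by lia. simpl pred.
match goal with |- @eq _ ?x ?y => change (@eq R x y) end. ring.
Qed.

(** Exchanging the variables reduces the derivative in [v] to the one in [u], and the edge [u = 0]
    to the edge [v = 0]. *)
Lemma form_rev (a : nat -> R) (d : nat) (u v : R) :
  form a d u v = form (fun i => a (d - i)%nat) d v u.
Proof.
unfold form.
assert (Rev : forall f : nat -> R, sum_n f d = sum_n (fun i => f (d - i)%nat) d).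
{ clear. intros f. revert f. induction d as [|d IH]; intros f;
    [rewrite !sum_O; reflexivity|].
  rewrite Rsum_Sn, Rsum_shift, IH, Nat.sub_0_r, Rplus_comm. reflexivity. }
rewrite Rev. apply sum_n_ext_loc; intros i Hi.
replace (d - (d - i))%nat with i by lia.
match goal with |- @eq _ ?x ?y => change (@eq R x y) end. ring.
Qed.

Lemma form_ext (a b : nat -> R) (d : nat) (u v : R) :
  (forall i, (i <= d)%nat -> a i = b i) -> form a d u v = form b d u v.
Proof.
intros H. apply sum_n_ext_loc; intros i Hi. rewrite H by exact Hi. reflexivity.
Qed.

Lemma is_derive_form_v (a : nat -> R) (d : nat) (u v : R) :
  is_derive (fun v => form a (S d) u v) v (form (dv_coef (INR (S d)) a) d u v).
Proof.
apply is_derive_ext with (fun v => form (fun i => a (S d - i)%nat) (S d) v u);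
  [intros t; symmetry; apply form_rev|].
evar_last; [apply is_derive_form_u|].
rewrite (form_rev (dv_coef _ _)). apply form_ext; intros i Hi.
unfold du_coef, dv_coef. rewrite S_INR, minus_INR by exact Hi.
replace (S d - S i)%nat with (d - i)%nat by lia. ring.
Qed.

Lemma is_derive_form_0 (a : nat -> R) (u v : R) :
  is_derive (fun u => form a 0 u v) u 0 /\ is_derive (fun v => form a 0 u v) v 0.
Proof.
split; apply is_derive_ext with (fun _ => a 0%nat * 1 * 1);
  try (intros; unfold form; rewrite sum_O; reflexivity);
  auto_derive; auto; ring.
Qed.

Lemma laplacian_form (p : Z -> Z -> R) (a : nat -> R) (e : nat) (u v : R) :
  laplacian p (form a (S (S e))) u v =
  form (lap_coef p (INR (S (S e))) a) e u v.
Proof.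
unfold laplacian, partial_derive, Derive_n.
assert (Du : forall b d u v, Derive (fun u => form b (S d) u v) u = form (du_coef b) d u v)
  by (intros; apply is_derive_unique, is_derive_form_u).
assert (Dv : forall b d u v, Derive (fun v => form b (S d) u v) v
    = form (dv_coef (INR (S d)) b) d u v)
  by (intros; apply is_derive_unique, is_derive_form_v).
rewrite (Derive_ext (fun x => Derive (fun t => form a (S (S e)) t v) x)
  (fun x => form (du_coef a) (S e) x v)) by (intros; apply Du).
rewrite (Derive_ext (fun x => Derive (fun z => form a (S (S e)) x z) v)
  (fun x => form (dv_coef (INR (S (S e))) a) (S e) x v)) by (intros; apply Dv).
rewrite (Derive_ext (fun x => Derive (fun z => form a (S (S e)) u z) x)
  (fun x => form (dv_coef (INR (S (S e))) a) (S e) u x)) by (intros; apply Dv).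
rewrite !Du, Dv. unfold form.
assert (Sp : forall f g : nat -> R, forall n, sum_n (fun i => f i + g i) n
  = sum_n f n + sum_n g n) by (intros f g n; exact (sum_n_plus f g n)).
assert (Sm : forall (s : R) (f : nat -> R) n, s * sum_n f n = sum_n (fun i => s * f i) n)
  by (intros s f n; symmetry; exact (sum_n_mult_l s f n)).
rewrite !Sm, <- !Sp, !Sm. apply sum_n_ext_loc; intros i Hi.
unfold lap_coef, du_coef, dv_coef. rewrite !S_INR.
match goal with |- @eq _ ?x ?y => change (@eq R x y) end. field.
Qed.

Lemma continuity_2d_pt_form (a : nat -> R) (d : nat) (x y : R) :
  continuity_2d_pt (form a d) x y.
Proof.
assert (Pw : forall (f : R -> R -> R) n, continuity_2d_pt f x y ->
  continuity_2d_pt (fun u v => f u v ^ n) x y).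
{ intros f n Hf. induction n as [|n IH]; [exact (continuity_2d_pt_const x y 1)|].
  apply (continuity_2d_pt_mult f (fun u v => f u v ^ n)); assumption. }
assert (T : forall i, continuity_2d_pt (fun u v => a i * u ^ i * v ^ (d - i)) x y).
{ intros i. apply continuity_2d_pt_mult; [apply continuity_2d_pt_mult|].
  - apply continuity_2d_pt_const.
  - apply (Pw (fun u _ => u)), continuity_2d_pt_id1.
  - apply (Pw (fun _ v => v)), continuity_2d_pt_id2. }
assert (Sn : forall n, continuity_2d_pt
  (fun u v => sum_n (fun i => a i * u ^ i * v ^ (d - i)) n) x y); [|exact (Sn d)].
intros n; induction n as [|n IH].
- apply continuity_2d_pt_ext with (2 := T 0%nat). intros; rewrite sum_O; reflexivity.
- apply continuity_2d_pt_ext with (2 := continuity_2d_pt_plus _ _ x y IH (T (S n))).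
  intros; rewrite Rsum_Sn; reflexivity.
Qed.

(** Both partial derivatives of a form are forms of degree [pred d]; for a constant they are the
    zero form of degree 0. *)
Lemma ex_diff_n_form (n d : nat) (a : nat -> R) (x y : R) : ex_diff_n (form a d) n x y.
Proof.
revert d a x y; induction n as [|n IH]; intros d a x y;
  (split; [apply continuity_2d_pt_form|]); [exact I|].
assert (E : exists b c, forall u v,
  is_derive (fun u => form a d u v) u (form b (pred d) u v) /\
  is_derive (fun v => form a d u v) v (form c (pred d) u v)).
{ destruct d as [|d].
  - exists (fun _ => 0), (fun _ => 0). intros u v.
    replace (form (fun _ => 0) (pred 0) u v) with 0
      by (unfold form; simpl; rewrite sum_O; ring).
    apply is_derive_form_0.
  - exists (du_coef a), (dv_coef (INR (S d)) a). intros u v.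
    split; [apply is_derive_form_u | apply is_derive_form_v]. }
destruct E as [b [c E]].
split; [exists (form b (pred d) x y); exact (proj1 (E x y))|].
split; [exists (form c (pred d) x y); exact (proj2 (E x y))|]. split.
- apply ex_diff_n_ext_loc with (2 := IH (pred d) b x y).
  exists (mkposreal 1 Rlt_0_1). intros u v _ _.
  symmetry. exact (is_derive_unique _ _ _ (proj1 (E u v))).
- apply ex_diff_n_ext_loc with (2 := IH (pred d) c x y).
  exists (mkposreal 1 Rlt_0_1). intros u v _ _.
  symmetry. exact (is_derive_unique _ _ _ (proj2 (E u v))).
Qed.

Lemma form_boundary (a : nat -> R) (d : nat) (t : R) :
  a 0%nat = 0 -> a d = 0 -> form a d t 0 = 0 /\ form a d 0 t = 0.
Proof.
assert (Z : forall b, b d = 0 -> form b d t 0 = 0).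
{ intros b Hb. unfold form.
  rewrite (sum_n_ext_loc _ (fun _ => 0 : R)).
  - rewrite sum_n_const. ring.
  - intros i Hi. destruct (Nat.eq_dec i d) as [->|N].
    + rewrite Hb, !Rmult_0_l. reflexivity.
    + rewrite (pow_i (d - i)) by lia. apply Rmult_0_r. }
intros H0 Hd. split; [apply Z, Hd|]. rewrite form_rev. apply Z.
rewrite Nat.sub_diag. exact H0.
Qed.

Lemma polyharmonic_form (p : Z -> Z -> R) (n d : nat) (a : nat -> R) :
  a 0%nat = 0 -> a d = 0 ->
  (forall u v, 0 < u -> 0 < v -> Nat.iter n (laplacian p) (form a d) u v = 0) ->
  polyharmonic p n (form a d).
Proof.
intros H0 Hd Hn. split; [|split].
- intros u v Hu Hv. split; [apply ex_diff_n_form | apply Hn; assumption].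
- intros u v _ _. assert (Cf := continuity_2d_pt_form a d u v).
  apply continuity_2d_pt_filterlim in Cf.
  refine (filterlim_filter_le_1 _ _ Cf).
  intros P HP. apply filter_imp with (2 := HP). auto.
- intros t _. apply form_boundary; assumption.
Qed.

(** * Laplace integrals of monomials *)

Definition is_derive_C (f : R -> C) (u : R) (l : C) : Prop :=
  is_derive (fun t => Re (f t)) u (Re l) /\ is_derive (fun t => Im (f t)) u (Im l).

Lemma is_derive_C_plus (f g : R -> C) (u : R) (l m : C) :
  is_derive_C f u l -> is_derive_C g u m ->
  is_derive_C (fun t => f t + g t)%C u (l + m)%C.
Proof.
intros [F1 F2] [G1 G2]; split.
- exact (is_derive_plus (V := R_NormedModule) _ _ u _ _ F1 G1).
- exact (is_derive_plus (V := R_NormedModule) _ _ u _ _ F2 G2).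
Qed.

Lemma is_derive_C_mult (f g : R -> C) (u : R) (l m : C) :
  is_derive_C f u l -> is_derive_C g u m ->
  is_derive_C (fun t => f t * g t)%C u (l * g u + f u * m)%C.
Proof.
intros [F1 F2] [G1 G2].
assert (M : forall h k : R -> R, forall s t, is_derive h u s -> is_derive k u t ->
  is_derive (fun x => h x * k x) u (s * k u + h u * t)).
{ intros h k s t Hh Hk.
  exact (is_derive_mult (K := R_AbsRing) h k u s t Hh Hk Rmult_comm). }
split.
- evar_last; [exact (is_derive_minus (V := R_NormedModule) _ _ u _ _
    (M _ _ _ _ F1 G1) (M _ _ _ _ F2 G2))|].
  unfold minus, plus, opp; simpl; unfold Re, Im; simpl; ring.
- evar_last; [exact (is_derive_plus (V := R_NormedModule) _ _ u _ _
    (M _ _ _ _ F1 G2) (M _ _ _ _ F2 G1))|].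
  unfold plus; simpl; unfold Re, Im; simpl; ring.
Qed.

Lemma is_derive_C_const (c : C) (u : R) : is_derive_C (fun _ => c) u 0.
Proof. split; apply (is_derive_const (V := R_NormedModule)). Qed.

Lemma is_derive_C_pow (i : nat) (u : R) :
  is_derive_C (fun t => RtoC (t ^ i)) u (RtoC (INR i * u ^ pred i)).
Proof.
split; simpl.
- auto_derive; [exact I|ring].
- apply (is_derive_const (V := R_NormedModule)).
Qed.

Lemma is_derive_C_exp (x : C) (u : R) :
  is_derive_C (fun t => Cexp (- (t * x))) u (- x * Cexp (- (u * x)))%C.
Proof.
destruct x as [s t]. unfold is_derive_C, Cexp, RtoC, Cmult, Copp; simpl.
split; auto_derive; auto; unfold Rminus; ring.
Qed.

Lemma exp_INR_mult (n : nat) (z : R) : exp (INR n * z) = exp z ^ n.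
Proof.
induction n as [|n IH]; [simpl; rewrite Rmult_0_l; apply exp_0|].
rewrite S_INR, Rmult_plus_distr_r, Rmult_1_l, exp_plus, IH. simpl; ring.
Qed.

(** With [n = i + 1], the inequality [e^t >= 1 + t] at [t = u s / n], raised to the power [n], gives
    [e^(u s) >= (u s / n)^n]. The product is thus at most a constant times [1 / u]. *)
Lemma exp_pow_decay (i : nat) (s : R) : 0 < s ->
  is_lim (fun u => u ^ i * exp (- (u * s))) p_infty 0.
Proof.
intros Hs. set (n := INR (S i)).
assert (Hn : 0 < n) by (apply lt_0_INR; lia).
apply is_lim_le_le_loc with (fun _ => 0) (fun u => (n / s) ^ S i * / u).
- exists 0. intros u Hu.
  assert (P0 : 0 < u ^ i) by (apply pow_lt; lra).
  split.
  + apply Rmult_le_pos; [lra|apply Rlt_le, exp_pos].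
  + assert (X : exp (u * s) = exp (u * s / n) ^ S i).
    { rewrite <- exp_INR_mult. f_equal. fold n. field. lra. }
    assert (Y : (u * s / n) ^ S i <= exp (u * s)).
    { rewrite X. apply pow_incr. split.
      - apply Rlt_le, Rdiv_lt_0_compat; [apply Rmult_lt_0_compat|]; lra.
      - pose proof (exp_ineq1_le (u * s / n)). lra. }
    rewrite exp_Ropp.
    assert (Q : 0 < (u * s / n) ^ S i).
    { apply pow_lt, Rdiv_lt_0_compat; [apply Rmult_lt_0_compat|]; lra. }
    apply Rle_trans with (u ^ i * / ((u * s / n) ^ S i)).
    * apply Rmult_le_compat_l; [lra|]. apply Rinv_le_contravar; assumption.
    * right. replace (u * s / n) with (u * (s / n)) by (field; lra).
      rewrite Rpow_mult_distr. replace (n / s) with (/ (s / n)) by (field; lra).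
      rewrite pow_inv. simpl (u ^ S i).
      assert (0 < (s / n) ^ S i) by (apply pow_lt, Rdiv_lt_0_compat; lra).
      field. lra.
- apply is_lim_const.
- evar_last; [apply is_lim_scal_l; apply is_lim_inv; [apply is_lim_id|discriminate]|].
  simpl. f_equal; ring.
Qed.

Definition vanishes (f : R -> C) : Prop :=
  is_lim (fun u => Re (f u)) p_infty 0 /\ is_lim (fun u => Im (f u)) p_infty 0.

Lemma vanishes_plus (f g : R -> C) :
  vanishes f -> vanishes g -> vanishes (fun u => f u + g u)%C.
Proof.
intros [F1 F2] [G1 G2]; split; replace (Finite 0) with (Finite (0 + 0)) by (f_equal; ring).
- apply (is_lim_plus' _ _ p_infty 0 0 F1 G1).
- apply (is_lim_plus' _ _ p_infty 0 0 F2 G2).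
Qed.

Lemma vanishes_scal (k : C) (f : R -> C) :
  vanishes f -> vanishes (fun u => k * f u)%C.
Proof.
intros [F1 F2].
assert (S : forall (s : R) h, is_lim h p_infty 0 -> is_lim (fun u => s * h u) p_infty 0).
{ intros s h Hh. evar_last; [apply is_lim_scal_l, Hh|]. simpl; f_equal; ring. }
split.
- replace (Finite 0) with (Finite (0 - 0)) by (f_equal; ring).
  apply (is_lim_minus' _ _ p_infty 0 0 (S (Re k) _ F1) (S (Im k) _ F2)).
- replace (Finite 0) with (Finite (0 + 0)) by (f_equal; ring).
  apply (is_lim_plus' _ _ p_infty 0 0 (S (Re k) _ F2) (S (Im k) _ F1)).
Qed.

Lemma vanishes_pow_exp (i : nat) (x : C) : 0 < Re x ->
  vanishes (fun u => RtoC (u ^ i) * Cexp (- (u * x)))%C.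
Proof.
intros Hx. destruct x as [s t]; simpl in Hx.
assert (B : forall b : R -> R, (forall u, -1 <= b u <= 1) ->
  is_lim (fun u => u ^ i * exp (- (u * s)) * b u) p_infty 0).
{ intros b Hb. assert (L := exp_pow_decay i s Hx).
  apply is_lim_le_le_loc with (fun u => - (u ^ i * exp (- (u * s))))
    (fun u => u ^ i * exp (- (u * s)));
    [|evar_last; [apply is_lim_opp, L|simpl; f_equal; ring]|exact L].
  exists 0. intros u Hu.
  assert (0 <= u ^ i * exp (- (u * s)))
    by (apply Rmult_le_pos; [apply pow_le; lra|apply Rlt_le, exp_pos]).
  pose proof (Hb u). split; nra. }
split.
- apply is_lim_ext with (2 := B (fun u => cos (- (u * t))) (fun u => COS_bound _)).
  intros u. unfold Cexp, RtoC, Cmult, Copp; simpl.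
  replace (- (u * s - 0 * t)) with (- (u * s)) by ring.
  replace (- (u * t + 0 * s)) with (- (u * t)) by ring. ring.
- apply is_lim_ext with (2 := B (fun u => sin (- (u * t))) (fun u => SIN_bound _)).
  intros u. unfold Cexp, RtoC, Cmult, Copp; simpl.
  replace (- (u * s - 0 * t)) with (- (u * s)) by ring.
  replace (- (u * t + 0 * s)) with (- (u * t)) by ring. ring.
Qed.

(** The primitive of [u^i e^(-u x)] given by repeated integration by parts, with the constant for
    which it vanishes at infinity when [Re x > 0]. *)
Fixpoint pow_exp_primitive (x : C) (i : nat) (u : R) : C :=
  (- / x * (RtoC (u ^ i) * Cexp (- (u * x)))
   + match i with O => 0 | S j => INR i * / x * pow_exp_primitive x j u end)%C.

Lemma pow_exp_primitive_spec (x : C) (i : nat) : 0 < Re x ->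
  (forall u, is_derive_C (pow_exp_primitive x i) u (RtoC (u ^ i) * Cexp (- (u * x)))%C) /\
  vanishes (pow_exp_primitive x i) /\
  pow_exp_primitive x i 0 = (- (INR (fact i) * (/ x) ^ S i))%C.
Proof.
intros Hx.
assert (X0 : x <> 0) by (intros E; rewrite E in Hx; simpl in Hx; lra).
assert (T : forall i u, is_derive_C (fun t => - / x * (RtoC (t ^ i) * Cexp (- (t * x))))%C u
  (RtoC (u ^ i) * Cexp (- (u * x)) - INR i * / x * (RtoC (u ^ pred i) * Cexp (- (u * x))))%C).
{ intros j u. evar (l : C). replace (RtoC (u ^ j) * Cexp (- (u * x)) - _)%C with l.
  - apply is_derive_C_mult; [apply is_derive_C_const|].
    apply is_derive_C_mult; [apply is_derive_C_pow|apply is_derive_C_exp].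
  - unfold l. rewrite RtoC_mult. field. exact X0. }
assert (E0 : Cexp (- (0 * x)) = 1).
{ replace (- (0 * x))%C with (RtoC 0) by ring. unfold Cexp, RtoC; simpl.
  rewrite exp_0, cos_0, sin_0. f_equal; ring. }
induction i as [|i [IH1 [IH2 IH3]]].
- split; [|split].
  + intros u. evar (l : C). replace (RtoC (u ^ 0) * Cexp (- (u * x)))%C with l.
    * apply is_derive_C_plus; [apply T|apply is_derive_C_const].
    * unfold l. simpl INR. ring.
  + simpl. apply vanishes_plus.
    * apply vanishes_scal, (vanishes_pow_exp 0 x Hx).
    * split; apply is_lim_const.
  + simpl. rewrite E0. ring.
- split; [|split].
  + intros u. evar (l : C). replace (RtoC (u ^ S i) * Cexp (- (u * x)))%C with l.
    * apply is_derive_C_plus; [apply T|].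
      apply is_derive_C_mult; [apply is_derive_C_const|apply IH1].
    * unfold l. simpl pred. ring.
  + apply vanishes_plus; apply vanishes_scal; [apply (vanishes_pow_exp (S i) x Hx)|exact IH2].
  + change (pow_exp_primitive x (S i) 0) with
      (- / x * (RtoC (0 ^ S i) * Cexp (- (0 * x)))
       + INR (S i) * / x * pow_exp_primitive x i 0)%C.
    rewrite IH3, E0, fact_simpl, mult_INR, RtoC_mult, !Cpow_S, pow_ne_zero by lia. ring.
Qed.

Lemma is_RInt_gen_pow_exp (k x : C) (i : nat) : 0 < Re x ->
  is_RInt_gen (V := C_R_NormedModule)
    (fun u : R => k * (RtoC (u ^ i) * Cexp (- (u * x))))%C
    (at_point 0) (Rbar_locally p_infty) (k * (INR (fact i) * (/ x) ^ S i))%C.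
Proof.
intros Hx. destruct (pow_exp_primitive_spec x i Hx) as [D [V E]].
set (g := fun u : R => (k * (RtoC (u ^ i) * Cexp (- (u * x))))%C).
set (G := fun u => (k * pow_exp_primitive x i u)%C).
assert (DG : forall u, is_derive_C G u (g u)).
{ intros u. evar (l : C). replace (g u) with l.
  - apply is_derive_C_mult; [apply is_derive_C_const|apply D].
  - unfold l, g. ring. }
assert (VG : vanishes G) by (apply vanishes_scal, V).
assert (Cg1 : forall u, continuous (fun t => Re (g t)) u).
{ intros u. apply (ex_derive_continuous (V := R_NormedModule)).
  unfold g, Cexp, RtoC, Cmult, Copp; destruct k, x; simpl. auto_derive; exact I. }
assert (Cg2 : forall u, continuous (fun t => Im (g t)) u).
{ intros u. apply (ex_derive_continuous (V := R_NormedModule)).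
  unfold g, Cexp, RtoC, Cmult, Copp; destruct k, x; simpl. auto_derive; exact I. }
assert (I : forall b, is_RInt (V := C_R_NormedModule) g 0 b (G b - G 0)%C).
{ intros b. apply (is_RInt_fct_extend_pair g 0 b).
  - exact (is_RInt_derive (V := R_CompleteNormedModule) (fun t => Re (G t)) _ 0 b
      (fun t _ => proj1 (DG t)) (fun t _ => Cg1 t)).
  - exact (is_RInt_derive (V := R_CompleteNormedModule) (fun t => Im (G t)) _ 0 b
      (fun t _ => proj2 (DG t)) (fun t _ => Cg2 t)). }
assert (L : filterlim (fun b => (G b - G 0)%C) (Rbar_locally p_infty)
  (locally (T := C_UniformSpace) (k * (INR (fact i) * (/ x) ^ S i))%C)).
{ replace (k * (INR (fact i) * (/ x) ^ S i))%C with (- G 0)%C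
    by (unfold G; rewrite E; ring).
  destruct VG as [V1 V2].
  assert (W1 := is_lim_minus' _ _ p_infty _ _ V1 (is_lim_const (Re (G 0)) p_infty)).
  assert (W2 := is_lim_minus' _ _ p_infty _ _ V2 (is_lim_const (Im (G 0)) p_infty)).
  replace (- G 0)%C with ((0 - Re (G 0), 0 - Im (G 0)) : C)
    by (destruct (G 0) as [s t]; unfold Copp; simpl; f_equal; ring).
  intros P [eps HP].
  assert (F1 := W1 _ (locally_ball (0 - Re (G 0)) eps)).
  assert (F2 := W2 _ (locally_ball (0 - Im (G 0)) eps)).
  destruct F1 as [M1 F1]. destruct F2 as [M2 F2]. exists (Rmax M1 M2). intros b Hb.
  pose proof (Rmax_l M1 M2). pose proof (Rmax_r M1 M2).
  apply HP. split; [apply F1|apply F2]; lra. }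
intros P HP. specialize (L P HP).
apply (Filter_prod _ _ _ (fun a => a = 0) (fun b => P (G b - G 0)%C)); [reflexivity|exact L|].
intros a b -> Hb. exists (G b - G 0)%C. split; [apply I|exact Hb].
Qed.

Lemma is_RInt_gen_Csum (f : nat -> R -> C) (l : nat -> C) (n : nat) :
  (forall i, is_RInt_gen (V := C_R_NormedModule) (f i)
     (at_point 0) (Rbar_locally p_infty) (l i)) ->
  is_RInt_gen (V := C_R_NormedModule) (fun u => sum_n (fun i => f i u) n : C)
    (at_point 0) (Rbar_locally p_infty) (sum_n l n).
Proof.
intros H. induction n as [|n IH].
- replace (fun u => sum_n (fun i => f i u) 0 : C) with (f 0%nat)
    by (apply functional_extensionality; intros; rewrite sum_O; reflexivity).
  rewrite sum_O. apply H.
- replace (fun u => sum_n (fun i => f i u) (S n) : C)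
    with (fun u => plus (G := C_R_NormedModule) (sum_n (fun i => f i u) n) (f (S n) u))
    by (apply functional_extensionality; intros; rewrite Csum_Sn; reflexivity).
  rewrite Csum_Sn.
  apply (is_RInt_gen_plus (V := C_R_NormedModule)); [exact IH|apply H].
Qed.

Lemma Cexp_plus (w z : C) : Cexp (w + z) = (Cexp w * Cexp z)%C.
Proof.
destruct w, z. unfold Cexp, Cmult; simpl. rewrite exp_plus, cos_plus, sin_plus. f_equal; ring.
Qed.

Lemma RtoC_form (a : nat -> R) (d : nat) (u v : R) :
  RtoC (form a d u v) =
  sum_n (fun i => RtoC (a i) * RtoC (u ^ i) * RtoC (v ^ (d - i)))%C d.
Proof.
unfold form.
assert (Sn : forall n, RtoC (sum_n (fun i => a i * u ^ i * v ^ (d - i)) n) =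
  sum_n (fun i => RtoC (a i) * RtoC (u ^ i) * RtoC (v ^ (d - i)))%C n); [|exact (Sn d)].
intros n; induction n as [|n IH].
- rewrite !sum_O, !RtoC_mult. reflexivity.
- rewrite Rsum_Sn, Csum_Sn, RtoC_plus, IH, !RtoC_mult. reflexivity.
Qed.

Lemma is_laplace_form (a : nat -> R) (d : nat) (x y : C) : 0 < Re x -> 0 < Re y ->
  is_laplace (form a d) x y (laplace_form a d x y).
Proof.
intros Hx Hy.
exists (fun v => sum_n (fun i => a i * INR (fact i) * (/ x) ^ S i *
  (RtoC (v ^ (d - i)) * Cexp (- (v * y))))%C d). split.
- intros v _. cbv beta.
  replace (fun u : R => (Cexp (- (u * x) - v * y) * form a d u v)%C)
    with (fun u : R => sum_n (fun i => a i * RtoC (v ^ (d - i)) * Cexp (- (v * y))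
      * (RtoC (u ^ i) * Cexp (- (u * x))))%C d : C).
  + replace (sum_n _ d) with (sum_n (fun i => a i * RtoC (v ^ (d - i)) * Cexp (- (v * y))
      * (INR (fact i) * (/ x) ^ S i))%C d) by (apply Csum_ext; intros; cring).
    apply (is_RInt_gen_Csum (fun i u => a i * RtoC (v ^ (d - i)) * Cexp (- (v * y))
      * (RtoC (u ^ i) * Cexp (- (u * x))))%C).
    intros i. apply is_RInt_gen_pow_exp, Hx.
  + apply functional_extensionality; intros u.
    replace (- (u * x) - v * y)%C with (- (u * x) + - (v * y))%C by ring.
    rewrite Cexp_plus, RtoC_form, <- Csum_mult_l. apply Csum_ext; intros; cring.
- unfold laplace_form.
  replace (sum_n _ d) with (sum_n (fun i => a i * INR (fact i) * (/ x) ^ S i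
    * (INR (fact (d - i)) * (/ y) ^ S (d - i)))%C d).
  + apply (is_RInt_gen_Csum (fun i v => a i * INR (fact i) * (/ x) ^ S i *
      (RtoC (v ^ (d - i)) * Cexp (- (v * y))))%C).
    intros i. apply is_RInt_gen_pow_exp, Hy.
  + apply Csum_ext; intros i _. unfold scaled. rewrite !RtoC_mult. cring.
Qed.

(** * Identification of the family with the polynomials *)

Lemma kernel_quotient_intro (p : Z -> Z -> R) (G : C -> C -> C) (a : nat -> R)
    (d : nat) :
  (forall x y : C, x <> 0 -> y <> 0 ->
     (gamma p x y * laplace_form a d x y = G x y)%C) ->
  is_kernel_quotient p G (laplace_form a d).
Proof.
intros HG. split.
- intros x y Hx Hy. apply continuous_laplace_form; assumption.
- intros x y Hx Hy Hg. rewrite <- HG by assumption. field. exact Hg.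
Qed.

Lemma laplace_family_eq (p : Z -> Z -> R) (N k : nat) (F : nat -> C -> C -> C)
    (f : nat -> C -> C) (a : nat -> nat -> R) (beta : nat -> C) :
  zero_drift_model p -> is_laplace_family p (Z.of_nat N) k F f ->
  (forall x y : C, x <> 0 -> y <> 0 ->
     gamma p x y * laplace_form (a 0%nat) (N * k) x y =
     (/ x) ^ (N * k) - (/ (c_plus p * y)) ^ (N * k))%C ->
  (forall n, laplace_step p (degree (N * k) n) (a n) (a (S n)) (beta n)) ->
  forall n (x y : C), x <> 0 -> y <> 0 ->
    F (S n) x y = laplace_form (a n) (degree (N * k) n) x y.
Proof.
intros H [HF1 HF] H0 Hs.
assert (C1 := c_plus_neq0 p H).
induction n as [|n IH]; intros x y Hx Hy.
- refine (kernel_quotient_eq p _ _ (laplace_form (a 0%nat) (N * k)) H HF1 _ _ x y Hx Hy).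
  + intros; apply continuous_laplace_form; assumption.
  + intros x' y' Hx' Hy'. rewrite !omega_hat_pow by Cneq0. apply H0; assumption.
- destruct (HF (S n) ltac:(lia)) as [Hd Hq].
  assert (Hf := decoupling_unique p _ _ _ _ _ _ H (Hs n) IH Hd).
  refine (kernel_quotient_eq p _ _ (laplace_form (a (S n)) (degree (N * k) (S n)))
    H Hq _ _ x y Hx Hy).
  + intros; apply continuous_laplace_form; assumption.
  + intros x' y' Hx' Hy'. rewrite !IH, !Hf by Cneq0. apply (Hs n); assumption.
Qed.

(** The polynomials are numbered from 0 and the family from 1, whence [pred]; the value at [n = 0]
    is arbitrary. *)
Lemma laplace_family_exists (p : Z -> Z -> R) (N k : nat)
    (a : nat -> nat -> R) (beta : nat -> C) :
  zero_drift_model p ->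
  (forall x y : C, x <> 0 -> y <> 0 ->
     gamma p x y * laplace_form (a 0%nat) (N * k) x y =
     (/ x) ^ (N * k) - (/ (c_plus p * y)) ^ (N * k))%C ->
  (forall n, laplace_step p (degree (N * k) n) (a n) (a (S n)) (beta n)) ->
  is_laplace_family p (Z.of_nat N) k
    (fun n => laplace_form (a (pred n)) (degree (N * k) (pred n)))
    (fun n x => beta (pred n) * (/ x) ^ S (S (degree (N * k) (pred n))))%C.
Proof.
intros H H0 Hs. assert (C1 := c_plus_neq0 p H). split.
- apply kernel_quotient_intro. intros x y Hx Hy.
  rewrite !omega_hat_pow by Cneq0. apply H0; assumption.
- intros [|n] Hn; [lia|]. split.
  + apply (step_decoupling p _ _ _ _ _ _ H (Hs n)); reflexivity.
  + apply kernel_quotient_intro. apply (Hs n).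
Qed.

(** The zero function at index 0 makes harmonicity of the first polynomial an instance of the rule
    that the Laplacian lowers the index by one. *)
Definition wedge_poly (a : nat -> nat -> R) (d n : nat) : R -> R -> R :=
  match n with O => fun _ _ => 0 | S m => form (a m) (degree d m) end.

Lemma laplacian_wedge_poly (p : Z -> Z -> R) (d : nat) (a : nat -> nat -> R)
    (beta : nat -> C) : (2 <= d)%nat ->
  (forall i, lap_coef p (INR d) (a 0%nat) i = 0) ->
  (forall n, laplace_step p (degree d n) (a n) (a (S n)) (beta n)) ->
  forall n, laplacian p (wedge_poly a d (S n)) = wedge_poly a d n.
Proof.
intros Hd H0 Hs n.
apply functional_extensionality; intros u. apply functional_extensionality; intros v.
destruct n as [|n]; simpl.
- destruct d as [|[|e]]; [lia|lia|]. rewrite laplacian_form.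
  rewrite (form_ext _ (fun _ => 0)) by (intros; apply H0).
  unfold form. rewrite (sum_n_ext _ (fun _ => 0 : R)), sum_n_const; [ring|].
  intros; rewrite !Rmult_0_l; reflexivity.
- rewrite laplacian_form. apply form_ext; intros i _. apply (Hs n).
Qed.

Lemma iter_laplacian_wedge_poly (p : Z -> Z -> R) (d : nat) (a : nat -> nat -> R) :
  (forall n, laplacian p (wedge_poly a d (S n)) = wedge_poly a d n) ->
  forall n u v, Nat.iter n (laplacian p) (wedge_poly a d n) u v = 0.
Proof.
intros HL n; induction n as [|n IH]; intros u v; [reflexivity|].
rewrite Nat.iter_succ_r, HL. apply IH.
Qed.

Theorem theorem7 :
  forall (p : Z -> Z -> R) (N : Z) (k : nat),
    zero_drift_model p -> PI / theta p = IZR N -> (1 <= k)%nat ->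
    (exists (F : nat -> C -> C -> C) (f : nat -> C -> C),
       is_laplace_family p N k F f) /\
    (forall (F : nat -> C -> C -> C) (f : nat -> C -> C),
       is_laplace_family p N k F f ->
       (exists h : nat -> R -> R -> R,
          (forall u v : R, h 0%nat u v = 0) /\
          (forall n : nat, (1 <= n)%nat ->
             polyharmonic p n (h n) /\
             (forall u v : R, 0 < u -> 0 < v ->
                laplacian p (h n) u v = h (n - 1)%nat u v) /\
             (forall x y : C, 0 < Re x -> 0 < Re y ->
                is_laplace (h n) x y (F n x y)))) /\
       (forall n : nat, (1 <= n)%nat ->
          exists (alpha : nat) (q : C -> C -> C),
            is_homogeneous_polynomial q /\
            (forall x y : C, x <> 0 -> y <> 0 ->
               F n x y = (q x y / (x ^ alpha * y ^ alpha))%C))).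
Proof.
intros p NZ k H HNZ Hk.
destruct (theta_integer p NZ H HNZ) as [N2 HN].
assert (EN : NZ = Z.of_nat (Z.to_nat NZ)) by lia.
rewrite EN, <- INR_IZR_INZ in HN. rewrite EN.
assert (N2' : (2 <= Z.to_nat NZ)%nat) by lia.
set (N := Z.to_nat NZ) in *. clearbody N. clear NZ HNZ N2 EN.
destruct (wedge_sequence p N k H N2' HN Hk) as [a [beta [Ha [H0 [Hb Hs]]]]].
split; [eexists; eexists; exact (laplace_family_exists p N k a beta H Hb Hs)|].
intros F f HF.
assert (HFa := laplace_family_eq p N k F f a beta H HF Hb Hs).
assert (HL := laplacian_wedge_poly p (N * k) a beta ltac:(nia) H0 Hs).
split.
- exists (wedge_poly a (N * k)). split; [reflexivity|].
  intros [|n] Hn; [lia|]. split; [|split].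
  + destruct (wedge_span_boundary p N _ _ H HN (Ha n)) as [B0 B1].
    apply polyharmonic_form; [exact B0|exact B1|]. intros u v _ _.
    exact (iter_laplacian_wedge_poly p (N * k) a HL (S n) u v).
  + intros u v _ _. rewrite HL. simpl. rewrite Nat.sub_0_r. reflexivity.
  + intros x y Hx Hy.
    rewrite HFa by (intros E; subst; simpl in Hx, Hy; lra).
    apply is_laplace_form; assumption.
- intros [|n] Hn; [lia|].
  destruct (laplace_form_rational (a n) (degree (N * k) n)) as [q [Hq Eq]].
  exists (S (degree (N * k) n)), q. split; [exact Hq|].
  intros x y Hx Hy. rewrite HFa by assumption. apply Eq; assumption.
Qed.
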